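(* Let $R$ be a Cohen-Macaulay local ring of dimension $d\ge1$ with canonical module $\omega_R$. Let $M$ be a maximal Cohen-Macaulay $R$-module which is a vector bundle. Suppose that: (i) $\operatorname{Ext}^i_R(M,M)=0$ for all $i=1,\dots,d$; (ii) $\operatorname{Ext}^{d+1}_R(\operatorname{Tr}M,M^\dagger)=0$ (which holds, e.g., if $\operatorname{pd}_RM^*<\infty$ or $\operatorname{id}_RM^\dagger<\infty$). Then $M$ is free.
   Context: All rings are commutative, unital and Noetherian. $(-)^*=\operatorname{Hom}_R(-,R)$ and $(-)^\dagger=\operatorname{Hom}_R(-,\omega_R)$. A finitely generated module $M$ over a local ring $(R,\mathfrak m)$ is a vector bundle if $M_{\mathfrak p}$ is a free $R_{\mathfrak p}$-module for every $\mathfrak p\in\operatorname{Spec}R\setminus\{\mathfrak m\}$. A maximal Cohen-Macaulay module is a nonzero finitely generated module whose depth equals $\dim R$. The (Auslander) transpose $\operatorname{Tr}M$ is the cokernel of the dual map $F^*\to G^*$, where $G\to F\to M\to0$ is a minimal free presentation of $M$. $\operatorname{id}_R$ denotes injective dimension. *)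

(* Defs.v *)
From HB Require Import structures.
From mathcomp Require Import all_boot all_algebra.
From mathcomp Require Import boolp functions.
From mathcomp Require Import freeg ring.

Set Implicit Arguments.
Unset Strict Implicit.
Unset Printing Implicit Defensive.

Import GRing.Theory.

Local Open Scope ring_scope.
Local Open Scope quotient_scope.

(* The library structures on subsets (submodClosed, idealr, prime_idealr) are
   boolean predicates; by [asbool] every subset of a type is one, so they range
   over all submodules, all proper ideals and all prime ideals. *)

Section Submodules.
Variable R : comNzRingType.
Implicit Types U V : lmodType R.

Definition submod V (S : submodClosed V) : Type := {x : V | x \in S}.

Section SubmodInstances.
Variables (V : lmodType R) (S : submodClosed V).
HB.instance Definition _ := SubChoice.on (submod S).
HB.instance Definition _ := [SubChoice_isSubLmodule of submod S by <:].
End SubmodInstances.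

Definition kermod U V (f : {linear U -> V}) : {pred U} := fun x => f x == 0.

Lemma kermod_closed U V (f : {linear U -> V}) : submod_closed (kermod f).
Proof.
split=> [|a x y]; rewrite !unfold_in; first by rewrite linear0.
by move=> /eqP fx /eqP fy; rewrite linearP fx fy scaler0 addr0.
Qed.

HB.instance Definition _ U V (f : {linear U -> V}) :=
  GRing.isSubmodClosed.Build R U (kermod f) (kermod_closed f).

Definition immod U V (f : {linear U -> V}) : {pred V} :=
  fun y => `[< exists x, f x = y >].

Lemma immod_closed U V (f : {linear U -> V}) : submod_closed (immod f).
Proof.
split=> [|a x y]; rewrite !unfold_in.
  by apply/asboolP; exists 0; rewrite linear0.
move=> /asboolP[x' <-] /asboolP[y' <-]; apply/asboolP.
by exists (a *: x' + y'); rewrite linearP.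
Qed.

HB.instance Definition _ U V (f : {linear U -> V}) :=
  GRing.isSubmodClosed.Build R V (immod f) (immod_closed f).

End Submodules.

Section QuotientModule.
Variables (R : comNzRingType) (V : lmodType R) (S : submodClosed V).

(* [submodClosed] does not inherit from [zmodClosed], over which the library
   builds quotients. *)
Definition zpred_of_submod : {pred V} := fun x => x \in S.

Lemma zpred_of_submod_closed : zmod_closed zpred_of_submod.
Proof.
split=> [|x y Sx Sy]; first exact: (rpred0 S).
by rewrite -scaleN1r; apply: (rpredD (S := S)) => //; apply: (rpredZ (s := S)).
Qed.

HB.instance Definition _ :=
  GRing.isZmodClosed.Build V zpred_of_submod zpred_of_submod_closed.

Definition quotmod : Type := Quotient.quot zpred_of_submod.

HB.instance Definition _ := GRing.Zmodule.on quotmod.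

Definition quotmod_pi (x : V) : quotmod := \pi_(Quotient.quot zpred_of_submod) x.

Definition quotmod_scale (a : R) (x : quotmod) : quotmod :=
  quotmod_pi (a *: repr (x : Quotient.quot zpred_of_submod)).

Lemma quotmod_piP (x y : V) : quotmod_pi x = quotmod_pi y <-> x - y \in S.
Proof.
by split=> [/eqP|xy]; [|apply/eqP]; rewrite /quotmod_pi -Quotient.idealrBE.
Qed.

Lemma quotmod_piK (x : quotmod) : quotmod_pi (repr (x : Quotient.quot zpred_of_submod)) = x.
Proof. exact: reprK. Qed.

Lemma quotmod_piD x y : quotmod_pi (x + y) = quotmod_pi x + quotmod_pi y.
Proof. exact: (raddfD (\pi_(Quotient.quot zpred_of_submod))). Qed.

Lemma quotmod_piZ a x : quotmod_scale a (quotmod_pi x) = quotmod_pi (a *: x).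
Proof.
apply/quotmod_piP; rewrite -scalerBr rpredZ //.
by apply/quotmod_piP; rewrite quotmod_piK.
Qed.

Lemma quotmod_scaleA a b x :
  quotmod_scale a (quotmod_scale b x) = quotmod_scale (a * b) x.
Proof. by rewrite -[x]quotmod_piK !quotmod_piZ scalerA. Qed.

Lemma quotmod_scale1 : left_id 1 quotmod_scale.
Proof. by move=> x; rewrite -[x]quotmod_piK quotmod_piZ scale1r. Qed.

Lemma quotmod_scaleDr : right_distributive quotmod_scale +%R.
Proof.
move=> a x y; rewrite -[x]quotmod_piK -[y]quotmod_piK -quotmod_piD.
by rewrite !quotmod_piZ scalerDr quotmod_piD.
Qed.

Lemma quotmod_scaleDl x :
  {morph quotmod_scale^~ x : a b / a + b}.
Proof.
by move=> a b; rewrite -[x]quotmod_piK !quotmod_piZ scalerDl quotmod_piD.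
Qed.

HB.instance Definition _ := GRing.Zmodule_isLmodule.Build R quotmod
  quotmod_scaleA quotmod_scale1 quotmod_scaleDr quotmod_scaleDl.

End QuotientModule.

Section HomModule.
Variable R : comNzRingType.
Implicit Types U V W : lmodType R.

Definition linear_pred U V : {pred U -> V} := fun f => `[< linear f >].

Lemma linear_pred_closed U V : submod_closed (@linear_pred U V).
Proof.
split=> [|c f g]; rewrite !unfold_in.
  by apply/asboolP => a x y; rewrite /= scaler0 addr0.
move=> /asboolP lf /asboolP lg; apply/asboolP => a x y.
rewrite addrfctE scalrfctE lf lg !scalerDr !scalerA (mulrC c) addrACA.
by rewrite -scalerA.
Qed.

HB.instance Definition _ U V :=
  GRing.isSubmodClosed.Build R (U -> V) (@linear_pred U V)
    (@linear_pred_closed U V).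

Definition Hom_mod U V : lmodType R := submod (@linear_pred U V).

Definition precomp U V (f : {linear U -> V}) W (h : Hom_mod V W) : Hom_mod U W.
Proof.
exists (val h \o f).
case: h => h /=; rewrite !unfold_in => /asboolP lh; apply/asboolP => a x y.
by rewrite /= linearP lh.
Defined.

Lemma precomp_linear U V (f : {linear U -> V}) W : linear (@precomp U V f W).
Proof. by move=> a g h; apply/val_inj. Qed.

HB.instance Definition _ U V (f : {linear U -> V}) W :=
  GRing.isLinear.Build R (Hom_mod V W) (Hom_mod U W) *:%R (@precomp U V f W)
    (@precomp_linear U V f W).

End HomModule.

Section HomCohomology.
Variables (R : comNzRingType) (P : nat -> lmodType R).
Variables (d : forall n, {linear P n.+1 -> P n}) (N : lmodType R).

Definition hom_diff (n : nat) : {linear Hom_mod (P n) N -> Hom_mod (P n.+1) N} :=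
  @precomp R _ _ (d n) N.

Definition hom_cocycle (n : nat) : lmodType R := submod (kermod (hom_diff n)).

Definition hom_cobound (n : nat) : {pred hom_cocycle n} :=
  match n return {pred hom_cocycle n} with
  | 0 => fun z => z == 0
  | k.+1 => fun z => val z \in immod (hom_diff k)
  end.

Lemma hom_cobound_closed n : submod_closed (@hom_cobound n).
Proof.
case: n => [|n]; split=> [|a x y].
- by rewrite unfold_in.
- by rewrite !unfold_in => /eqP -> /eqP ->; rewrite scaler0 addr0.
- exact: (rpred0 (immod (hom_diff n))).
by move=> hx hy; apply: rpredD => //; apply: rpredZ.
Qed.

HB.instance Definition _ n :=
  GRing.isSubmodClosed.Build R (hom_cocycle n) (@hom_cobound n)
    (@hom_cobound_closed n).

(* The n-th cohomology of Hom(P, N), for P a complex in degrees >= 0. *)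
Definition hom_cohomology (n : nat) : lmodType R := quotmod (@hom_cobound n).

End HomCohomology.

Section Ext.
Variable R : comNzRingType.
Implicit Types M N : lmodType R.

(* The tautological surjection onto M from the free module on the set M. *)
Definition free_cover M (x : {freeg M / R}) : M := fglift id x.

Lemma free_cover_linear M : linear (@free_cover M).
Proof.
have fcD (x y : {freeg M / R}) :
    free_cover (x - y) = free_cover x - free_cover y.
  exact: lift_is_additive.
have fc0 : free_cover (0 : {freeg M / R}) = 0.
  by rewrite -(subrr 0) fcD subrr.
have fcN (y : {freeg M / R}) : free_cover (- y) = - free_cover y.
  by rewrite -sub0r fcD fc0 sub0r.
have fcA (x y : {freeg M / R}) :
    free_cover (x + y) = free_cover x + free_cover y.
  by rewrite -{1}[y]opprK fcD fcN opprK.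
have fcS (I : Type) (r : seq I) (F : I -> {freeg M / R}) :
    free_cover (\sum_(i <- r) F i) = \sum_(i <- r) free_cover (F i).
  by elim: r => [|i r IH]; rewrite ?big_nil ?big_cons ?fc0 // fcA IH.
move=> a x y; rewrite fcA; congr (_ + _).
rewrite -{2}[x]freeg_sumE fcS scaler_sumr /GRing.scale /= /fgscale fcS.
apply: eq_bigr => z _; rewrite /free_cover.
by rewrite !liftU -scalerA.
Qed.

HB.instance Definition _ M :=
  GRing.isLinear.Build R {freeg M / R} M *:%R (@free_cover M)
    (@free_cover_linear M).

Definition cover_ker M : lmodType R := submod (kermod (@free_cover M)).

Definition cover_diff M : {linear {freeg (cover_ker M) / R} -> {freeg M / R}} :=
  (val : {linear cover_ker M -> {freeg M / R}}) \o (@free_cover (cover_ker M)).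

(* The free resolution P_n = R^(Z_n) of M, where Z_0 = M and Z_(n+1) is the
   kernel of the tautological surjection R^(Z_n) -> Z_n. *)
Definition std_syz M (n : nat) : lmodType R := iter n cover_ker M.

Definition std_res M (n : nat) : lmodType R := {freeg (std_syz M n) / R}.

Definition std_diff M (n : nat) : {linear std_res M n.+1 -> std_res M n} :=
  cover_diff (std_syz M n).

Definition Ext (n : nat) M N : lmodType R := hom_cohomology (std_diff M) N n.

End Ext.

Section Localization.
Variables (R : comNzRingType) (p : prime_idealr R).

Definition denom : Type := {s : R | s \notin p}.

Lemma denom1_subproof : 1 \notin p.
Proof. by rewrite idealr1. Qed.

Lemma denomM_subproof (s t : denom) : sval s * sval t \notin p.
Proof. by rewrite prime_idealrM negb_or (proj2_sig s) (proj2_sig t). Qed.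

Definition denom1 : denom := exist (fun s : R => s \notin p) 1 denom1_subproof.
Definition denomM (s t : denom) : denom := exist (fun s : R => s \notin p) _ (denomM_subproof s t).

Section LocalizedGroup.
Variable V : lmodType R.
Implicit Types (x y : V) (s t u : denom).

(* x / s and y / t agree iff u *: (t *: x - s *: y) = 0 for some u. *)
Definition loc_rel (a b : V * denom) : bool :=
  `[< exists u : denom,
      (sval u * sval b.2) *: a.1 = (sval u * sval a.2) *: b.1 >].

Lemma loc_rel_equiv : equiv_class_of loc_rel.
Proof.
split=> [a|a b|b a c].
- by apply/asboolP; exists denom1.
- by apply/asboolP/asboolP => -[u e]; exists u.
move=> /asboolP[u e] /asboolP[v f]; apply/asboolP.
exists (denomM (denomM u v) b.2) => /=.
have -> : sval u * sval v * sval b.2 * sval c.2 = sval v * sval c.2 * (sval u * sval b.2).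
  by ring.
have -> : sval u * sval v * sval b.2 * sval a.2 = sval u * sval a.2 * (sval v * sval b.2).
  by ring.
by rewrite -[LHS]scalerA e scalerA [X in X *: _ = _]mulrC -[LHS]scalerA f scalerA.
Qed.

Canonical loc_rel_equivRel := EquivRelPack loc_rel_equiv.
Canonical loc_rel_encModRel := defaultEncModRel loc_rel.

(* The localization V_p; for V = R it is the ring R_p, called locring below. *)
Definition locmod : Type := {eq_quot loc_rel}.
HB.instance Definition _ := Choice.on locmod.

Definition locfrac x s : locmod := \pi_({eq_quot loc_rel}) (x, s).

Lemma locfracP x s y t : locfrac x s = locfrac y t <->
  exists u : denom, (sval u * sval t) *: x = (sval u * sval s) *: y.
Proof.
split=> [/eqP|h]; first by rewrite /locfrac piE => /asboolP.
by apply/eqP; rewrite /locfrac piE; apply/asboolP.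
Qed.

Definition locnum (z : locmod) : V := (repr (z : {eq_quot loc_rel})).1.
Definition locden (z : locmod) : denom := (repr (z : {eq_quot loc_rel})).2.

Lemma locfracK z : locfrac (locnum z) (locden z) = z.
Proof. by rewrite /locfrac -surjective_pairing; exact: reprK. Qed.

Lemma locfrac_ind (P : locmod -> Prop) :
  (forall x s, P (locfrac x s)) -> forall z, P z.
Proof. by move=> h z; rewrite -[z]locfracK. Qed.

Definition loc0 : locmod := locfrac 0 denom1.
Definition locN (z : locmod) : locmod := locfrac (- locnum z) (locden z).
Definition locD (z w : locmod) : locmod :=
  locfrac (sval (locden w) *: locnum z + sval (locden z) *: locnum w)
          (denomM (locden z) (locden w)).

Lemma locfracN x s : locN (locfrac x s) = locfrac (- x) s.
Proof.
have /locfracP[u e] := locfracK (locfrac x s).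
by apply/locfracP; exists u; rewrite !scalerN e.
Qed.

Lemma locfracD x s y t : locD (locfrac x s) (locfrac y t) =
  locfrac (sval t *: x + sval s *: y) (denomM s t).
Proof.
rewrite /locD; move: (locfracK (locfrac x s)) (locfracK (locfrac y t)).
move: (locnum (locfrac x s)) (locden (locfrac x s)) => x' s'.
move: (locnum (locfrac y t)) (locden (locfrac y t)) => y' t'.
move=> /locfracP[u e] /locfracP[v f].
apply/locfracP; exists (denomM u v) => /=; rewrite !scalerDr !scalerA.
congr (_ + _).
  rewrite [X in X *: _ = _](_ : _ = sval v * sval t * sval t' * (sval u * sval s)); last by ring.
  by rewrite -[LHS]scalerA e scalerA; congr (_ *: _); ring.
rewrite [X in X *: _ = _](_ : _ = sval u * sval s * sval s' * (sval v * sval t)); last by ring.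
by rewrite -[LHS]scalerA f scalerA; congr (_ *: _); ring.
Qed.

Lemma locfrac_eq x s y t : sval t *: x = sval s *: y -> locfrac x s = locfrac y t.
Proof. by move=> e; apply/locfracP; exists denom1; rewrite /= !mul1r. Qed.

Lemma locDA : associative locD.
Proof.
elim/locfrac_ind=> x s; elim/locfrac_ind=> y t; elim/locfrac_ind=> z w.
rewrite !locfracD; apply: locfrac_eq => /=.
by rewrite !scalerDr !scalerA addrA; congr (_ *: _ + _ *: _ + _ *: _); ring.
Qed.

Lemma locDC : commutative locD.
Proof.
elim/locfrac_ind=> x s; elim/locfrac_ind=> y t.
by rewrite !locfracD; apply: locfrac_eq; rewrite /= addrC (mulrC (sval s)).
Qed.

Lemma loc0D : left_id loc0 locD.
Proof.
elim/locfrac_ind=> x s; rewrite locfracD; apply: locfrac_eq.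
by rewrite /= scaler0 add0r scale1r mul1r.
Qed.

Lemma locND : left_inverse loc0 locN locD.
Proof.
elim/locfrac_ind=> x s; rewrite locfracN locfracD; apply: locfrac_eq.
by rewrite /= scalerN addNr !scaler0.
Qed.

HB.instance Definition _ := GRing.isZmodule.Build locmod locDA locDC loc0D locND.

End LocalizedGroup.

Definition locring : Type := locmod R^o.

HB.instance Definition _ := GRing.Zmodule.on locring.

Lemma locring_ind (P : locring -> Prop) :
  (forall (r : R^o) s, P (locfrac r s)) -> forall a, P a.
Proof. exact: (@locfrac_ind R^o). Qed.

Definition locact (V : lmodType R) (a : locring) (z : locmod V) : locmod V :=
  locfrac ((locnum a : R) *: locnum z) (denomM (locden a) (locden z)).

Lemma locfracZ (V : lmodType R) (r : R) s (x : V) t :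
  locact (locfrac (r : R^o) s) (locfrac x t) = locfrac (r *: x) (denomM s t).
Proof.
rewrite /locact; move: (locfracK (locfrac (r : R^o) s)) (locfracK (locfrac x t)).
move: (locnum (locfrac x t)) (locden (locfrac x t)) => x' t'.
move: (locnum (locfrac (r : R^o) s)) (locden (locfrac (r : R^o) s)) => r' s'.
move=> /locfracP[u e] /locfracP[v f].
have {}e : (sval u * sval s) * r' = (sval u * sval s') * r by exact: e.
apply/locfracP; exists (denomM u v) => /=; rewrite !scalerA.
rewrite [X in X *: _ = _](_ : _ = sval u * sval s * r' * (sval v * sval t)); last by ring.
by rewrite -[LHS]scalerA f e scalerA; congr (_ *: _); ring.
Qed.

Lemma locactA (V : lmodType R) (a b : locring) (z : locmod V) :
  locact a (locact b z) = locact (locact a b : locring) z.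
Proof.
elim/locring_ind: a => r s; elim/locring_ind: b => r' s'.
elim/locfrac_ind: z => x t; rewrite (locfracZ r s r' s') !locfracZ scalerA.
by apply: locfrac_eq => /=; rewrite mulrA.
Qed.

Lemma locact1 (V : lmodType R) : left_id (locfrac (1 : R^o) denom1) (@locact V).
Proof.
elim/locfrac_ind=> x t; rewrite locfracZ scale1r.
by apply: locfrac_eq; rewrite /= mul1r.
Qed.

Lemma locactDr (V : lmodType R) : right_distributive (@locact V) +%R.
Proof.
elim/locring_ind=> r s; elim/locfrac_ind=> x t; elim/locfrac_ind=> y w.
rewrite [_ + _]locfracD !locfracZ [RHS]locfracD; apply: locfrac_eq => /=.
by rewrite !scalerDr !scalerA; congr (_ *: _ + _ *: _); ring.
Qed.

Lemma locactDl (V : lmodType R) (z : locmod V) :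
  {morph (@locact V)^~ z : a b / a + b}.
Proof.
move=> a b; elim/locfrac_ind: z => x t.
elim/locring_ind: a => r s; elim/locring_ind: b => r' s'.
rewrite [_ + _]locfracD !locfracZ [RHS]locfracD; apply: locfrac_eq => /=.
rewrite !scalerDr !scalerDl !scalerDr !scalerA.
by congr (_ *: _ + _ *: _); rewrite /GRing.scale /=; ring.
Qed.

Lemma locactC : commutative (@locact R^o).
Proof.
elim/locring_ind=> r s; elim/locring_ind=> r' s'; rewrite !locfracZ.
by apply: locfrac_eq; rewrite /= /GRing.scale /=; ring.
Qed.

Lemma loc1_neq0 : locfrac (1 : R^o) denom1 != (0 : locring).
Proof.
apply/eqP => /locfracP[u] /=; rewrite scaler0 mulr1 /GRing.scale /= mulr1.
by move=> u0; have := proj2_sig u; rewrite u0 idealr0.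
Qed.

Lemma locmul_DlS : left_distributive (@locact R^o) +%R.
Proof. by move=> a b z; exact: locactDl. Qed.

Lemma locmulA : associative (@locact R^o).
Proof. exact: locactA. Qed.

HB.instance Definition _ := GRing.Zmodule_isComNzRing.Build locring
  locmulA locactC (@locact1 R^o) locmul_DlS loc1_neq0.

HB.instance Definition _ (V : lmodType R) :=
  GRing.Zmodule_isLmodule.Build locring (locmod V)
    (@locactA V) (@locact1 V) (@locactDr V) (@locactDl V).

End Localization.

Section Modules.
Variable R : comNzRingType.
Implicit Types U V W : lmodType R.

Definition is_zero V : Prop := forall x : V, x = 0.

Definition isom U V : Prop := exists f : {linear U -> V}, bijective f.

(* Free of finite rank; every module to which this is applied below is finitely
   generated. *)
Definition is_free V : Prop := exists n, isom 'rV[R]_n V.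

Definition finitely_generated V : Prop :=
  exists n (g : 'I_n -> V), forall x, exists c : 'I_n -> R,
    x = \sum_i c i *: g i.

Definition surjective U V (f : U -> V) : Prop := forall y, exists x, f x = y.

Definition exact_at U V W (f : U -> V) (g : V -> W) : Prop :=
  forall y, g y = 0 <-> exists x, f x = y.

Definition projective_module (P : lmodType R) : Prop :=
  forall U V (g : {linear U -> V}) (f : {linear P -> V}),
    surjective g -> exists h : {linear P -> U}, g \o h =1 f.

Definition injective_module (E : lmodType R) : Prop :=
  forall U V (g : {linear U -> V}) (f : {linear U -> E}),
    injective g -> exists h : {linear V -> E}, h \o g =1 f.

Definition finite_pd V : Prop :=
  exists (n : nat) (P : nat -> lmodType R)
         (d : forall i, {linear P i.+1 -> P i}) (e : {linear P 0 -> V}),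
    [/\ forall i, projective_module (P i), surjective e,
        exact_at (d 0) e, forall i, exact_at (d i.+1) (d i)
      & forall i, (n < i)%N -> is_zero (P i)].

Definition finite_id V : Prop :=
  exists (n : nat) (E : nat -> lmodType R)
         (d : forall i, {linear E i -> E i.+1}) (e : {linear V -> E 0}),
    [/\ forall i, injective_module (E i), injective e,
        exact_at e (d 0), forall i, exact_at (d i) (d i.+1)
      & forall i, (n < i)%N -> is_zero (E i)].

End Modules.

Section LocalRings.
Variable R : comNzRingType.
Implicit Types (V : lmodType R) (m : idealr R).

Definition noetherian : Prop :=
  forall I : submodClosed R^o, finitely_generated (submod I).

Definition maximal_ideal (I : idealr R) : Prop :=
  forall J : idealr R, {subset I <= J} -> J =i I.

Definition local_ring m : Prop :=
  maximal_ideal m /\ forall I : idealr R, maximal_ideal I -> I =i m.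

Definition ideal_submod (I : idealr R) : {pred R^o} := fun x => (x : R) \in I.

Lemma ideal_submod_closed (I : idealr R) : submod_closed (ideal_submod I).
Proof.
split=> [|a x y Ix Iy]; first exact: idealr0.
by apply: (rpredD (S := I)) => //; apply: idealMr.
Qed.

HB.instance Definition _ (I : idealr R) :=
  GRing.isSubmodClosed.Build R R^o (ideal_submod I) (ideal_submod_closed I).

(* R/m, as an R-module. *)
Definition residue_field m : lmodType R := quotmod (ideal_submod m).

Definition prime_chain (n : nat) (c : nat -> prime_idealr R) : Prop :=
  forall i, (i < n)%N ->
    {subset c i <= c i.+1} /\ exists2 x, x \in c i.+1 & x \notin c i.

Definition krull_dim (d : nat) : Prop :=
  (exists c, prime_chain d c) /\ (forall n c, prime_chain n c -> (n <= d)%N).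

(* u lies in (s_0, s_1, ...)V *)
Definition in_ideal_mul V (s : seq R) (u : V) : Prop :=
  exists v : 'I_(size s) -> V, u = \sum_(i < size s) s`_i *: v i.

Definition regular_seq V (s : seq R) : Prop :=
  (forall i, (i < size s)%N -> forall u : V,
     in_ideal_mul (take i s) (s`_i *: u) -> in_ideal_mul (take i s) u)
  /\ exists u : V, ~ in_ideal_mul s u.

Definition depth m V (t : nat) : Prop :=
  (exists s : seq R, [/\ size s = t, {subset s <= m} & regular_seq V s]) /\
  (forall s : seq R, {subset s <= m} -> regular_seq V s -> (size s <= t)%N).

Definition cohen_macaulay_ring m : Prop :=
  exists d, krull_dim d /\ depth m R^o d.

Definition maximal_cohen_macaulay m V : Prop :=
  [/\ finitely_generated V, ~ is_zero V & exists d, krull_dim d /\ depth m V d].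

(* A maximal Cohen-Macaulay module of finite injective dimension and of type 1,
   the type being the dimension of Ext^(dim R)(R/m, omega) over R/m. *)
Definition canonical_module m (omega : lmodType R) : Prop :=
  [/\ maximal_cohen_macaulay m omega, finite_id omega
    & exists d, krull_dim d /\
        isom (Ext d (residue_field m) omega) (residue_field m)].

Definition vector_bundle m V : Prop :=
  finitely_generated V /\
  forall p : prime_idealr R, ~ (p =i m) -> is_free (locmod p V).

(* R^q -> R^p -> V -> 0; minimality says that ker e and ker phi lie in m R^p
   and m R^q. *)
Definition minimal_presentation m V (q p : nat)
    (phi : {linear 'rV[R]_q -> 'rV[R]_p}) (e : {linear 'rV[R]_p -> V}) : Prop :=
  [/\ surjective e, exact_at phi e,
      forall x, e x = 0 -> forall j, x 0 j \in m
    & forall x, phi x = 0 -> forall j, x 0 j \in m].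

(* The transpose of coker phi. *)
Definition transpose (q p : nat) (phi : {linear 'rV[R]_q -> 'rV[R]_p}) :
    lmodType R :=
  quotmod (immod (@precomp R _ _ phi R^o)).

Definition dual_mod V : lmodType R := Hom_mod V R^o.

End LocalRings.

(* Main.v *)
(** Let T = Tr M, M^+ = Hom(M, omega) and H = Tor_1(T, M), which is End(M) modulo the maps that
    factor through a free module.  Since M is a vector bundle, for every x in the maximal ideal
    some x^l id_M factors through a free module of finite rank; hence every Tor_i(T, M) with i >= 1
    is killed by powers of the members of an omega-regular sequence of length d, so that
    Ext^j(Tor_i(T, M), omega) = 0 for j < d.  Tensoring a free resolution of T with M and dualizing
    into omega, where Ext^j(M, omega) = 0 for j >= 1 and Ext^j(-, omega) = 0 for j > d, dimension
    shifting shows that Ext^(d+1)(T, M^+) = 0 forces Ext^d(H, omega) = 0.  If H were nonzero it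
    would map onto the residue field k, giving Ext^d(k, omega) = 0, which is absurd.  So H = 0, the
    identity of M factors through a free module, and minimality of the presentation makes M free.

    For the second part, Bass' argument shows that Ext^j(-, N) vanishes on finitely generated
    modules for j > d as soon as N is finitely generated of finite injective dimension.  If M^* has
    finite projective dimension, so does T; then Ext^j(T, omega) = 0 for j > d propagates along
    omega ->> k and a devissage to all finitely generated coefficients, by descending induction
    on j.

    Only the vanishing of Ext modules is ever used, never the modules themselves. *)
Require Import Defs.
From HB Require Import structures.
From mathcomp Require Import all_boot all_algebra.
From mathcomp Require Import boolp functions.
From mathcomp Require Import freeg ring.

Set Implicit Arguments.
Unset Strict Implicit.
Unset Printing Implicit Defensive.

Import GRing.Theory.
Local Open Scope ring_scope.


(** * Linear maps and extensions *)

Section Homological.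
Variable R : comNzRingType.
Implicit Types A B C K L P Q X Y N W KX PX KY PY KA KB KC PA PB PC : lmodType R.
Implicit Types c : R.

Definition mklin A B (f : A -> B) (lf : linear f) : {linear A -> B} :=
  HB.pack f (GRing.isLinear.Build R A B *:%R f lf).

Lemma linear_ex A B (f : A -> B) : linear f -> exists g : {linear A -> B}, g =1 f.
Proof. by move=> lf; exists (mklin lf). Qed.

Lemma pair_ex A B C (f : {linear A -> C}) (g : {linear B -> C}) :
  exists h : {linear (A * B)%type -> C}, forall z, h z = f z.1 + g z.2.
Proof.
apply: linear_ex => a x y /=.
by rewrite !linearP scalerDr addrACA.
Qed.

Lemma pairing_ex A B C (f : {linear A -> B}) (g : {linear A -> C}) :
  exists h : {linear A -> (B * C)%type}, forall x, h x = (f x, g x).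
Proof. by apply: linear_ex => a x y; rewrite (linearP f) (linearP g). Qed.

Lemma pairD B C (x y : B * C) : x + y = (x.1 + y.1, x.2 + y.2).
Proof. by []. Qed.

Lemma comb_ex A B (c : R) (f g : {linear A -> B}) :
  exists h : {linear A -> B}, forall x, h x = c *: f x + g x.
Proof.
by apply: linear_ex => a x y; rewrite (linearP f) (linearP g) !scalerDr !scalerA (mulrC c) addrACA.
Qed.

Definition ses A B C (i : {linear A -> B}) (g : {linear B -> C}) : Prop :=
  [/\ injective i, surjective g & exact_at i g].

Lemma exact0 A B C (i : {linear A -> B}) (g : {linear B -> C}) :
  exact_at i g -> forall x, g (i x) = 0.
Proof. by move=> e x; apply/e; exists x. Qed.

Lemma surj_factor_ex A B N (g : {linear A -> B}) (w : {linear A -> N}) :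
  surjective g -> (forall x, g x = 0 -> w x = 0) ->
  exists w' : {linear B -> N}, forall x, w' (g x) = w x.
Proof.
move=> /choice[r rK] gw.
have wr x y : g x = g y -> w x = w y.
  move=> e; apply/eqP; rewrite -subr_eq0 -linearB gw //.
  by rewrite linearB e subrr.
have [|w' w'E] := @linear_ex _ _ (fun y => w (r y)).
  by move=> a x y; rewrite -linearP; apply: wr; rewrite linearP !rK.
by exists w' => x; rewrite w'E; apply: wr; rewrite rK.
Qed.

Lemma inj_lift_ex A B L (i : {linear A -> B}) (w : {linear L -> B}) :
  injective i -> (forall x, exists a, i a = w x) ->
  exists w' : {linear L -> A}, forall x, i (w' x) = w x.
Proof.
move=> ii /choice[r rK].
have [|w' w'E] := @linear_ex _ _ r.
  by move=> a x y; apply: ii; rewrite linearP !rK linearP.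
by exists w' => x; rewrite w'E.
Qed.

Lemma ker_ses A B (g : {linear A -> B}) :
  surjective g -> exists K (i : {linear K -> A}), ses i g.
Proof.
move=> sg; exists (submod (kermod g)), (val : {linear submod (kermod g) -> A}).
split; [exact: val_inj | by [] | move=> y].
split=> [gy|[x <-]]; last by apply/eqP; exact: (valP x).
have yk : y \in kermod g by rewrite unfold_in gy.
by exists (exist _ y yk).
Qed.

Lemma im_ses A B (g : {linear A -> B}) : exists C (h : {linear A -> C}) (j : {linear C -> B}),
  [/\ surjective h, injective j & forall x, j (h x) = g x].
Proof.
pose j := (val : {linear submod (immod g) -> B}).
have [|h hE] := @inj_lift_ex _ _ _ j g (@val_inj _ _ _).
  move=> x; have xk : g x \in immod g by rewrite unfold_in; apply/asboolP; exists x.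
  by exists (exist (fun y => y \in immod g) _ xk).
exists (submod (immod g)), h, j; split; [move=> y | exact: val_inj | by []].
have := valP y; rewrite unfold_in => /asboolP[x xy].
by exists x; apply: val_inj; rewrite -[LHS]/(j _) hE xy.
Qed.

Definition piq B (S : submodClosed B) : B -> quotmod S := @quotmod_pi R B S.

Lemma piq_linear B (S : submodClosed B) : linear (@piq B S).
Proof. by move=> a x y; rewrite /piq quotmod_piD -quotmod_piZ. Qed.

Lemma quot_ex B (S : submodClosed B) : exists g : {linear B -> quotmod S},
  surjective g /\ forall x, g x = 0 <-> x \in S.
Proof.
have [g gE] := linear_ex (@piq_linear B S); exists g; split=> [y|x].
  by exists (repr (y : Quotient.quot (@zpred_of_submod R B S))); rewrite gE; apply: quotmod_piK.
rewrite -(linear0 g) !gE; rewrite -[X in _ <-> X \in _](subr0 x).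
exact: quotmod_piP.
Qed.

Lemma coker_ex A B (i : {linear A -> B}) : exists C (g : {linear B -> C}),
  surjective g /\ exact_at i g.
Proof.
have [g [sg gk]] := @quot_ex B (immod i).
exists (quotmod (immod i)), g; split=> // y; rewrite gk unfold_in.
by split=> [/asboolP|?] //; apply/asboolP.
Qed.

Lemma coker_ses A B (i : {linear A -> B}) : injective i ->
  exists C (g : {linear B -> C}), ses i g.
Proof. by move=> ii; have [C [g [sg eg]]] := coker_ex i; exists C, g; split. Qed.

Lemma fglift_linear X B (f : X -> B) : linear (fun x : {freeg X / R} => fglift f x).
Proof.
pose c (x : {freeg X / R}) : B := fglift f x.
have fcD (x y : {freeg X / R}) : c (x - y) = c x - c y by exact: lift_is_additive.
have fc0 : c 0 = 0 by rewrite -(subrr 0) fcD subrr.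
have fcN y : c (- y) = - c y by rewrite -sub0r fcD fc0 sub0r.
have fcA x y : c (x + y) = c x + c y by rewrite -{1}[y]opprK fcD fcN opprK.
have fcS (I : Type) (r : seq I) (F : I -> {freeg X / R}) :
    c (\sum_(i <- r) F i) = \sum_(i <- r) c (F i).
  by elim: r => [|i r IH]; rewrite ?big_nil ?big_cons ?fc0 // fcA IH.
move=> a x y; rewrite -!/(c _) fcA; congr (_ + _).
rewrite -{2}[x]freeg_sumE fcS scaler_sumr /GRing.scale /= /fgscale fcS.
by apply: eq_bigr => z _; rewrite /c !liftU -scalerA.
Qed.

Lemma freeg_ext X B (f g : {linear {freeg X / R} -> B}) :
  (forall x, f << x >> = g << x >>) -> f =1 g.
Proof.
move=> fg x; rewrite -[x]freeg_sumE !linear_sum; apply: eq_bigr => z _.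
have -> : << coeff z x *g z >> = coeff z x *: << z >> :> {freeg X / R}.
  by apply/eqP/freeg_eqP => k; rewrite coeffZ !coeffU mul1r.
by rewrite !linearZ /= fg.
Qed.

Lemma free_cover_surj X : surjective (@free_cover R X).
Proof. by move=> x; exists << x >>; rewrite /free_cover liftU scale1r. Qed.

Lemma freeg_projective X : projective_module {freeg X / R}.
Proof.
move=> U V g f sg.
have [r rK] := choice (fun x : X => sg (f << x >>)).
have [h hE] := linear_ex (fglift_linear r).
exists h => x; apply: (@freeg_ext _ _ (g \o h) f) => {}x /=.
by rewrite hE liftU scale1r rK.
Qed.

Lemma proj_cover X : exists K P (i : {linear K -> P}) (g : {linear P -> X}),
  ses i g /\ projective_module P.
Proof.
have [K [i e]] := ker_ses (@free_cover_surj X).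
by exists K, {freeg X / R}, i, (@free_cover R X); split=> //; apply: freeg_projective.
Qed.

Lemma prod_projective P Q : projective_module P -> projective_module Q ->
  projective_module (P * Q)%type.
Proof.
move=> pP pQ U V g f sg.
have [i1 i1E] := @pairing_ex P P Q idfun \0.
have [i2 i2E] := @pairing_ex Q P Q \0 idfun.
have [h1 h1E] := pP _ _ g (f \o i1) sg.
have [h2 h2E] := pQ _ _ g (f \o i2) sg.
have [h hE] := pair_ex h1 h2; exists h => z /=.
rewrite hE linearD /=; move: (h1E z.1) (h2E z.2) => /= -> ->.
rewrite i1E i2E -linearD; congr (f _).
by rewrite pairD /= addr0 add0r -surjective_pairing.
Qed.

Lemma row_projective n : projective_module 'rV[R]_n.
Proof.
move=> U V g f sg.
have [r rK] := choice (fun i : 'I_n => sg (f (delta_mx 0 i))).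
have [h hE] : exists h : {linear 'rV[R]_n -> U}, forall x, h x = \sum_i x 0 i *: r i.
  apply: linear_ex => a x y; rewrite scaler_sumr -big_split /=.
  by apply: eq_bigr => i _; rewrite !mxE scalerDl scalerA.
exists h => x /=; rewrite hE linear_sum [in RHS](row_sum_delta x) linear_sum.
by apply: eq_bigr => i _; rewrite !linearZ /= rK.
Qed.

(* [Ext^1 X N = 0], tested on every extension [L] of X and not only on projective covers. *)
Definition ext1_zero X N := forall K L (i : {linear K -> L}) (g : {linear L -> X}),
  ses i g -> forall u : {linear K -> N}, exists v : {linear L -> N}, forall x, v (i x) = u x.

(** One projective presentation decides all extensions. Lifting [P] to [L] exhibits [L] as a
    quotient of [K' * P], and [u] on [K'] glues with an extension to [P] of its restriction to
    [K]. *)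
Lemma ext1_zero_cover X N K P (i : {linear K -> P}) (g : {linear P -> X}) :
  ses i g -> projective_module P ->
  (forall u : {linear K -> N}, exists v : {linear P -> N}, forall x, v (i x) = u x) ->
  ext1_zero X N.
Proof.
move=> [ii sg eg] pP ext K' L i' g' [ii' sg' eg'] u.
have [h hE] := pP _ _ g' g sg'.
have [h' h'E] : exists h' : {linear K -> K'}, forall x, i' (h' x) = (h \o i) x.
  apply: inj_lift_ex => // x; apply/eg'; move: (hE (i x)) => /= ->.
  by apply/eg; exists x.
have [v vE] := ext (u \o h').
have [s sE] := pair_ex i' h.
have [w wE] := pair_ex u v.
have [||w' w'E] := @surj_factor_ex _ _ _ s w.
- move=> l; have [p pl] := sg (g' l).
  have /eg'[k kE] : g' (l - h p) = 0.
    by rewrite linearB /=; move: (hE p) => /= ->; rewrite pl subrr.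
  by exists (k, p); rewrite sE /= kE subrK.
- move=> [k p]; rewrite sE wE /= => e.
  have /eg[k1 k1E] : g p = 0.
    move: (hE p) => /= <-.
    by have := congr1 g' e; rewrite linearD linear0 (exact0 eg') add0r.
  rewrite -k1E vE /= -linearD; have -> : k + h' k1 = 0.
    by apply: ii'; rewrite linearD h'E /= k1E e linear0.
  by rewrite linear0.
exists w' => x; have := w'E (x, 0); rewrite sE wE /= !linear0 !addr0 //.
Qed.

(* [c] times the identity of X factors through Y up to a map that factors
   through a projective module. *)
Definition stable_retract (c : R) X Y := exists (f : {linear X -> Y}) (g : {linear Y -> X})
  P (a : {linear X -> P}) (b : {linear P -> X}),
  projective_module P /\ forall x, c *: x = g (f x) + b (a x).

(** Lift [f], [g] and [b] to the projective modules. The defect [c - G F - b' a gX] maps [PX] into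
    the kernel [KX], and on [KX] its last term vanishes. *)
Lemma stable_retract_syz c X Y KX PX KY PY
  (iX : {linear KX -> PX}) (gX : {linear PX -> X})
  (iY : {linear KY -> PY}) (gY : {linear PY -> Y}) :
  ses iX gX -> projective_module PX -> ses iY gY -> projective_module PY ->
  stable_retract c X Y -> exists (F : {linear PX -> PY}) (f : {linear KX -> KY})
   (g : {linear KY -> KX}) (h : {linear PX -> KX}),
   (forall x, iY (f x) = F (iX x)) /\ forall x, c *: x = g (f x) + h (iX x).
Proof.
move=> [iiX sX eX] pX [iiY sY eY] pY [f [g [P [a [b [pP E]]]]]].
have [F FE] := pX _ _ gY (f \o gX) sY.
have [G GE] := pY _ _ gX (g \o gY) sX.
have [b' b'E] := pP _ _ gX b sX.
have FE' x : gY (F x) = f (gX x) by exact: FE.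
have GE' x : gX (G x) = g (gY x) by exact: GE.
have bE x : gX (b' x) = b x by exact: b'E.
have [f' f'E] : exists f' : {linear KX -> KY}, forall x, iY (f' x) = (F \o iX) x.
  apply: inj_lift_ex => // x; apply/eY; rewrite /= FE'.
  by rewrite (exact0 eX) linear0.
have [g' g'E] : exists g' : {linear KY -> KX}, forall x, iX (g' x) = (G \o iY) x.
  apply: inj_lift_ex => // x; apply/eX; rewrite /= GE'.
  by rewrite (exact0 eY) linear0.
have [w0 w0E] := comb_ex (-1) (b' \o (a \o gX)) \0.
have [w1 w1E] := comb_ex (-1) (G \o F) w0.
have [w wE'] := comb_ex c idfun w1.
have wE x : w x = c *: x - G (F x) - b' (a (gX x)).
  by rewrite wE' w1E w0E /= !scaleN1r addr0 addrA.
have [h hE] : exists h : {linear PX -> KX}, forall x, iX (h x) = w x.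
  apply: inj_lift_ex => // x; apply/eX; rewrite wE !linearB linearZ /= GE' FE' bE E.
  by rewrite -addrA -opprD subrr.
exists F, f', g', h; split=> // x; apply: iiX.
rewrite linearD linearZ /= hE wE g'E /= f'E /=.
by rewrite (exact0 eX) !linear0 addr0 addrC subrK.
Qed.

Lemma stable_retract_ker c X Y KX PX KY PY
  (iX : {linear KX -> PX}) (gX : {linear PX -> X})
  (iY : {linear KY -> PY}) (gY : {linear PY -> Y}) :
  ses iX gX -> projective_module PX -> ses iY gY -> projective_module PY ->
  stable_retract c X Y -> stable_retract c KX KY.
Proof.
move=> sX pX sY pY h; have [_ [f [g [k [_ E]]]]] := stable_retract_syz sX pX sY pY h.
by exists f, g, PX, iX, k.
Qed.

(** In other words, [c] annihilates Ext^1(X, N): extend [u \o g'] over the presentation of Y, pull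
    back along [F] and correct by [u \o k]. *)
Lemma stable_retract_ext1 c X Y N : stable_retract c X Y -> ext1_zero Y N ->
  forall K P (i : {linear K -> P}) (g : {linear P -> X}),
  ses i g -> projective_module P ->
  forall u : {linear K -> N}, exists v : {linear P -> N}, forall x, v (i x) = c *: u x.
Proof.
move=> h eY K P i g sX pP u.
have [KY [PY [iY [gY [sY pY]]]]] := proj_cover Y.
have [F [f' [g' [k [FE E]]]]] := stable_retract_syz sX pP sY pY h.
have [v vE] := eY _ _ _ _ sY (u \o g').
have [w wE] : exists w : {linear P -> N}, forall x, w x = v (F x) + u (k x).
  by apply: linear_ex => r x y; rewrite !linearP /= scalerDr addrACA.
by exists w => x; rewrite wE -FE vE /= -linearD -E linearZ.
Qed.
End Homological.

(** * Vanishing of Ext *)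

Section ExtVanishing.
Variable R : comNzRingType.
Implicit Types A B C K L P Q X Y N W KX PX KY PY KA KB KC PA PB PC : lmodType R.
Implicit Types c : R.

(* [Ext^n X N = 0]; for positive n this is a statement about Ext^1, since [std_syz X n'] is the
   n'-th syzygy of X. *)
Definition ext_zero n X N : Prop :=
  if n is n'.+1 then ext1_zero (std_syz X n') N
  else forall (u : {linear X -> N}) x, u x = 0.

Lemma std_ses X : ses (val : {linear cover_ker X -> {freeg X / R}}) (@free_cover R X).
Proof.
split; [exact: val_inj | exact: free_cover_surj | move=> y].
split=> [gy|[x <-]]; last by apply/eqP; exact: (valP x).
have yk : y \in kermod (@free_cover R X) by rewrite unfold_in gy.
by exists (exist (fun y => y \in kermod (@free_cover R X)) y yk).
Qed.

Lemma hom_linear A N (h : Hom_mod A N) : linear (val h).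
Proof. by case: h => h /=; rewrite unfold_in => /asboolP. Qed.

Lemma hom_ex A N (u : {linear A -> N}) : exists h : Hom_mod A N, val h = u.
Proof.
have lu : (u : A -> N) \in @linear_pred R A N.
  by rewrite unfold_in; apply/asboolP => a x y; rewrite linearP.
by exists (exist (fun f => f \in @linear_pred R A N) _ lu).
Qed.

Lemma hom_valP A N a (h h' : Hom_mod A N) x :
  val (a *: h + h') x = a *: val h x + val h' x.
Proof. by []. Qed.

Lemma hom_eq A N (h h' : Hom_mod A N) : (forall x, val h x = val h' x) -> h = h'.
Proof. by move=> hh'; apply/val_inj/funext. Qed.

Lemma quotmod_is_zero B (S : submodClosed B) :
  is_zero (quotmod S) <-> forall x, x \in S.
Proof.
have [g [sg gk]] := quot_ex S; split=> [z x|h y]; first by apply/gk; exact: z.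
by have [x <-] := sg y; apply/gk.
Qed.

Lemma hom_cohomology_is_zero (P : nat -> lmodType R)
    (d : forall n, {linear P n.+1 -> P n}) N n :
  is_zero (hom_cohomology d N n.+1) <->
  forall u : {linear P n.+1 -> N}, (forall x, u (d n.+1 x) = 0) ->
  exists v : {linear P n -> N}, forall x, v (d n x) = u x.
Proof.
rewrite /hom_cohomology quotmod_is_zero; split=> [H u ud|H [h hk]].
  have [h hE] := hom_ex u.
  have hk : h \in kermod (hom_diff d N n.+1).
    by rewrite unfold_in; apply/eqP/val_inj/funext => x /=; rewrite hE /= ud.
  have := H (exist (fun h => h \in kermod (hom_diff d N n.+1)) h hk).
  rewrite unfold_in /= unfold_in => /asboolP[v vE].
  exists (mklin (hom_linear v)) => x.
  by have := congr1 (fun f : Hom_mod _ _ => val f x) vE; rewrite /= hE.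
rewrite unfold_in /= unfold_in; apply/asboolP.
have hk' := hk; rewrite unfold_in in hk'; move/eqP: hk' => hk'.
have [|v vE] := H (mklin (hom_linear h)).
  by move=> x; have := congr1 (fun f : Hom_mod _ _ => val f x) hk'.
have [v' v'E] := hom_ex v; exists v'; apply/val_inj/funext => x /=.
by rewrite v'E vE.
Qed.

(** A cocycle on [P'] kills the image of [i'], which is the kernel of [g'], so cocycles are maps
    [K -> N]; the coboundaries among them are those that extend to [P]. *)
Lemma ext1_zero_three X N K P K' P' P'' (i : {linear K -> P}) (g : {linear P -> X})
    (i' : {linear K' -> P'}) (g' : {linear P' -> K}) (c : {linear P'' -> K'})
    (d : {linear P' -> P}) (d' : {linear P'' -> P'}) :
  ses i g -> projective_module P -> ses i' g' -> surjective c ->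
  (forall x, d x = i (g' x)) -> (forall x, d' x = i' (c x)) ->
  (forall u : {linear P' -> N}, (forall x, u (d' x) = 0) ->
     exists v : {linear P -> N}, forall x, v (d x) = u x) <->
  ext1_zero X N.
Proof.
move=> s pP [_ sg' eg'] sc dE d'E; split=> [H|H u ud].
  apply: (ext1_zero_cover s pP) => u.
  have [|v vE] := H (u \o g').
    by move=> x /=; rewrite d'E (exact0 eg') linear0.
  by exists v => k; have [y <-] := sg' k; rewrite -dE; exact: vE.
have [|u' u'E] := @surj_factor_ex _ _ _ _ g' u sg'.
  by move=> x /eg'[y <-]; have [t <-] := sc y; rewrite -d'E; apply: ud.
have [v vE] := H _ _ _ _ s u'.
by exists v => x; rewrite -u'E dE; apply: vE.
Qed.

Lemma cover_diff_ext1 X N :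
  (forall u : {linear {freeg (cover_ker X) / R} -> N},
     (forall x, u (cover_diff (cover_ker X) x) = 0) ->
   exists v : {linear {freeg X / R} -> N}, forall x, v (cover_diff X x) = u x) <->
  ext1_zero X N.
Proof.
exact: (ext1_zero_three (d := cover_diff X) (d' := cover_diff (cover_ker X)) N
  (std_ses X) (@freeg_projective _ _)
  (std_ses (cover_ker X)) (@free_cover_surj _ (cover_ker (cover_ker X)))
  (fun=> erefl) (fun=> erefl)).
Qed.

(** The bridge between the cohomology modules of the theorem and the extension problems of the
    proof. *)
Lemma Ext_is_zero n X N : is_zero (Ext n.+1 X N) <-> ext_zero n.+1 X N.
Proof.
rewrite /Ext hom_cohomology_is_zero; exact: (cover_diff_ext1 (std_syz X n) N).
Qed.

Lemma ext1_zero_retract X Y N : stable_retract 1 X Y -> ext1_zero Y N -> ext1_zero X N.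
Proof.
move=> r eY; have [K [P [i [g [s pP]]]]] := proj_cover X.
apply: (ext1_zero_cover s pP) => u.
have [v vE] := stable_retract_ext1 r eY s pP u.
by exists v => x; rewrite vE scale1r.
Qed.

Lemma ext_zeroSS n X N : ext_zero n.+2 X N = ext_zero n.+1 (cover_ker X) N.
Proof. by rewrite /ext_zero /std_syz iterSr. Qed.

Lemma ext_zero_retract n X Y N :
  stable_retract 1 X Y -> ext_zero n.+1 Y N -> ext_zero n.+1 X N.
Proof.
elim: n X Y => [|n IH] X Y r; first exact: ext1_zero_retract.
rewrite !ext_zeroSS; apply: IH.
exact: (stable_retract_ker (std_ses X) (@freeg_projective _ _) (std_ses Y) (@freeg_projective _ _)).
Qed.

Lemma stable_retract_split c X Y (f : {linear X -> Y}) (g : {linear Y -> X}) :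
  (forall x, g (f x) = c *: x) -> stable_retract c X Y.
Proof.
move=> fg; exists f, g, 'rV[R]_0, \0, \0; split; first exact: row_projective.
by move=> x; rewrite fg addr0.
Qed.

(** As in Schanuel's lemma, any two syzygies of X are stable retracts of each other with [c = 1], so
    K may replace the standard one. *)
Lemma ext_zero_syz n X N K P (i : {linear K -> P}) (g : {linear P -> X}) :
  ses i g -> projective_module P -> ext_zero n.+2 X N <-> ext_zero n.+1 K N.
Proof.
move=> s pP; have rX : stable_retract 1 X X.
  by apply: (@stable_retract_split _ _ _ idfun idfun) => x; rewrite scale1r.
rewrite ext_zeroSS; split; apply: ext_zero_retract.
  exact: (stable_retract_ker s pP (std_ses X) (@freeg_projective _ _)).
exact: (stable_retract_ker (std_ses X) (@freeg_projective _ _) s pP).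
Qed.

Lemma ext_zero_projective n P N : projective_module P -> ext_zero n.+1 P N.
Proof.
have z0 : is_zero 'rV[R]_0 by move=> x; apply/rowP; case.
elim: n P => [|n IH] P pP.
all: have s : ses (\0 : {linear 'rV[R]_0 -> P}) (idfun : {linear P -> P})
  by split=> [x y _|y|y]; [rewrite (z0 x) (z0 y) | exists y |
     split=> [/= -> |[x <-]]; [exists 0 |]].
  by apply: (ext1_zero_cover s pP) => u; exists \0 => x; rewrite (z0 x) !linear0.
by apply/(ext_zero_syz n N s pP)/IH; apply: row_projective.
Qed.

(** * Long exact sequences in the first variable *)

Section Sequences.
Variables (A B C : lmodType R) (i : {linear A -> B}) (g : {linear B -> C}).
Hypothesis s : ses i g.

(* From [0 -> A -> B -> C -> 0] to [0 -> Omega B -> Omega C -> A -> 0]. *)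
Lemma rotate_left KB P KC (iB : {linear KB -> P}) (gB : {linear P -> B}) (iC : {linear KC -> P}) :
  ses iB gB -> ses iC (g \o gB) ->
  exists (j : {linear KB -> KC}) (q : {linear KC -> A}),
    [/\ ses j q, forall x, iC (j x) = iB x & forall x, i (q x) = gB (iC x)].
Proof.
move=> [iiB sB eB] [iiC sC eC]; have [ii sg eg] := s.
have [j jE] : exists j : {linear KB -> KC}, forall x, iC (j x) = iB x.
  by apply: inj_lift_ex => // x; apply/eC => /=; rewrite (exact0 eB) linear0.
have [q qE] : exists q : {linear KC -> A}, forall x, i (q x) = (gB \o iC) x.
  by apply: inj_lift_ex => // x; apply/eg => /=; exact: (exact0 eC).
exists j, q; split=> //; split=> [x y xy|a|k].
- by apply: iiB; rewrite -!jE xy.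
- have [p pa] := sB (i a).
  have /eC[k kp] : (g \o gB) p = 0 by rewrite /= pa (exact0 eg).
  by exists k; apply: ii; rewrite qE /= kp.
split=> [qk|[x <-]]; last by apply: ii; rewrite qE /= jE (exact0 eB) linear0.
have /eB[x xk] : gB (iC k) = 0 by rewrite -[LHS]/((gB \o iC) k) -qE qk linear0.
by exists x; apply: iiC; rewrite jE.
Qed.

(* From [0 -> A -> B -> C -> 0] to [0 -> Omega C -> A (+) P -> B -> 0]. *)
Lemma rotate_right KC P (iC : {linear KC -> P}) (gC : {linear P -> C}) :
  ses iC gC -> projective_module P ->
  exists (j : {linear KC -> (A * P)%type}) (q : {linear (A * P)%type -> B}), ses j q.
Proof.
move=> [iiC sC eC] pP; have [ii sg eg] := s.
have [h hE] := pP _ _ g gC sg; have {}hE x : g (h x) = gC x by exact: hE.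
have [k kE] : exists k : {linear KC -> A}, forall x, i (k x) = (h \o iC) x.
  by apply: inj_lift_ex => // x; apply/eg => /=; rewrite hE (exact0 eC).
have [k' k'E] := comb_ex (-1) k \0.
have [j jE'] := pairing_ex k' iC.
have jE x : j x = (- k x, iC x) by rewrite jE' k'E scaleN1r addr0.
have [q qE] := pair_ex i h; exists j, q; split=> [x y|b|[a p]].
- by rewrite !jE => -[_] /iiC.
- have [p pb] := sC (g b).
  have /eg[a ab] : g (b - h p) = 0 by rewrite linearB /= hE pb subrr.
  by exists (a, p); rewrite qE /= ab subrK.
rewrite qE /=; split=> [e|[x]]; last first.
  by rewrite jE => -[<- <-]; rewrite linearN /= kE addNr.
have /eC[x xp] : gC p = 0.
  by have := congr1 g e; rewrite linearD linear0 (exact0 eg) add0r hE.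
exists x; rewrite jE xp; congr (_, _); apply: ii; rewrite linearN /= kE /= xp.
by apply/eqP; rewrite eq_sym -addr_eq0 e.
Qed.

End Sequences.

(** Along Omega B -> Omega C -> A, a map on Omega B extends first to Omega C and then to [P]. In the
    names ending in [sesm], [sesr], [sesl] and [coefm], [coefr], [coefl] the last letter tells which
    term (middle, right, left) receives the vanishing. *)
Lemma ext1_zero_sesm N A B C (i : {linear A -> B}) (g : {linear B -> C}) :
  ses i g -> ext1_zero A N -> ext1_zero C N -> ext1_zero B N.
Proof.
move=> s eA eC; have [K [P [iB [gB [sB pP]]]]] := proj_cover B.
have sgg : surjective (g \o gB).
  have [_ sg _] := s; have [_ sgB _] := sB.
  by move=> c; have [b <-] := sg c; have [p <-] := sgB b; exists p.
have [KC [iC sC]] := ker_ses sgg.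
have [j [q [sr jE _]]] := rotate_left s sB sC.
apply: (ext1_zero_cover sB pP) => u.
have [v vE] := eA _ _ _ _ sr u; have [w wE] := eC _ _ _ _ sC v.
by exists w => x; rewrite -jE wE vE.
Qed.

Lemma comp_surj A B C (f : {linear A -> B}) (g : {linear B -> C}) :
  surjective f -> surjective g -> surjective (g \o f).
Proof. by move=> sf sg c; have [b <-] := sg c; have [a <-] := sf b; exists a. Qed.

(** Exactness of Hom(B, N) -> Hom(A, N) -> Ext^1(C, N) -> Ext^1(B, N): after subtraction of a map on
    [P], [u] vanishes on Omega B, so it comes from A and hence from B. *)
Lemma ext1_zero_quot N A B C (i : {linear A -> B}) (g : {linear B -> C}) :
  ses i g -> ext1_zero B N ->
  (forall u : {linear A -> N}, exists v : {linear B -> N}, forall x, v (i x) = u x) ->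
  ext1_zero C N.
Proof.
move=> s eB ext; have [K [P [iB [gB [sB pP]]]]] := proj_cover B.
have [_ sg _] := s; have [_ sgB _] := sB.
have [KC [iC sC]] := ker_ses (comp_surj sgB sg).
have [j [q [sr jE qE]]] := rotate_left s sB sC.
apply: (ext1_zero_cover sC pP) => u.
have [v vE] := eB _ _ _ _ sB (u \o j).
have [w wE] := comb_ex (-1) (v \o iC) u.
have [_ sq eq] := sr.
have [|w' w'E] := @surj_factor_ex _ _ _ _ q w sq.
  by move=> x /eq[y <-]; rewrite wE /= jE vE /= scaleN1r addNr.
have [t tE] := ext w'.
exists (v \+ (t \o gB)) => x /=.
by rewrite -qE tE w'E wE /= scaleN1r addrA subrr add0r.
Qed.

Lemma stable_retract_prod A P : stable_retract 1 A (A * P)%type.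
Proof.
have [i1 i1E] := @pairing_ex R A A P idfun \0.
by apply: (@stable_retract_split _ _ _ i1 fst) => x; rewrite i1E scale1r.
Qed.

(** Two rotations give Omega A -> Omega B (+) Q -> Omega C, which lowers the degree by one. *)
Lemma ext_zero_sesm n N A B C (i : {linear A -> B}) (g : {linear B -> C}) :
  ses i g -> ext_zero n.+1 A N -> ext_zero n.+1 C N -> ext_zero n.+1 B N.
Proof.
elim: n A B C i g => [|n IH] A B C i g s eA eC; first exact: ext1_zero_sesm s _ _.
have [K [P [iB [gB [sB pP]]]]] := proj_cover B.
have [_ sg _] := s; have [_ sgB _] := sB.
have [KC [iC sC]] := ker_ses (comp_surj sgB sg).
have [j [q [sr jE qE]]] := rotate_left s sB sC.
apply/(ext_zero_syz n N sB pP).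
have {}eC : ext_zero n.+1 KC N by apply/(ext_zero_syz n N sC pP).
have [KA [Q [iA [gA [sA pQ]]]]] := proj_cover A.
have [j' [q' sr']] := rotate_right sr sA pQ.
apply: (ext_zero_retract (stable_retract_prod _ Q)).
apply: IH sr' _ eC.
by apply/(ext_zero_syz n N sA pQ).
Qed.

(** After rotation Omega C is the middle term, between Omega B and A. For [n = 0] the only map from
    A to N is zero, so nothing has to be extended. *)
Lemma ext_zero_sesr n N A B C (i : {linear A -> B}) (g : {linear B -> C}) :
  ses i g -> ext_zero n A N -> ext_zero n.+1 B N -> ext_zero n.+1 C N.
Proof.
case: n => [|n] s eA eB.
  by apply: (ext1_zero_quot s eB) => u; exists \0 => x; rewrite eA.
have [K [P [iB [gB [sB pP]]]]] := proj_cover B.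
have [_ sg _] := s; have [_ sgB _] := sB.
have [KC [iC sC]] := ker_ses (comp_surj sgB sg).
have [j [q [sr jE qE]]] := rotate_left s sB sC.
apply/(ext_zero_syz n N sC pP); apply: ext_zero_sesm sr _ eA.
by apply/(ext_zero_syz n N sB pP).
Qed.

(** The other rotation makes A, up to a projective summand, the middle term between Omega C and
    B. *)
Lemma ext_zero_sesl n N A B C (i : {linear A -> B}) (g : {linear B -> C}) :
  ses i g -> ext_zero n.+1 B N -> ext_zero n.+2 C N -> ext_zero n.+1 A N.
Proof.
move=> s eB eC; have [K [P [iC [gC [sC pP]]]]] := proj_cover C.
have [j [q sr]] := rotate_right s sC pP.
apply: (ext_zero_retract (stable_retract_prod A P)).
by apply: ext_zero_sesm sr _ eB; apply/(ext_zero_syz n N sC pP).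
Qed.

End ExtVanishing.

(** * Change of coefficients *)

Section Covariant.
Variable R : comNzRingType.
Implicit Types A B C K L P Q X Y N W H KX PX KY PY KA KB KC PA PB PC : lmodType R.
Implicit Types c : R.

Section Coefficients.
Variables (N' N N'' : lmodType R) (i : {linear N' -> N}) (g : {linear N -> N''}).
Hypothesis s : ses i g.

Lemma ext_zero_coefm n X :
  ext_zero n.+1 X N' -> ext_zero n.+1 X N'' -> ext_zero n.+1 X N.
Proof.
rewrite /ext_zero; move: (std_syz X n) => {n}X e' e''.
have [ii sg eg] := s; have [K [P [iX [gX [sX pP]]]]] := proj_cover X.
apply: (ext1_zero_cover sX pP) => u.
have [w wE] := e'' _ _ _ _ sX (g \o u).
have [w' w'E] := pP _ _ g w sg.
have [t tE] := comb_ex (-1) (w' \o iX) u.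
have [|v vE] := inj_lift_ex (w := t) ii.
  move=> k; apply/eg; rewrite tE linearD linearZ /=.
  by move: (w'E (iX k)) => /= ->; rewrite wE /= scaleN1r addNr.
have [r rE] := e' _ _ _ _ sX v.
by exists (w' \+ (i \o r)) => k /=; rewrite rE vE tE /= scaleN1r addrA subrr add0r.
Qed.

(** The hypothesis on [K] is the vanishing of Ext^2(X, N'). Lift [u] to N over a cover of K; the
    obstruction on the second syzygy takes values in [N'] and is removed by extending it to the
    cover. *)
Lemma ext1_zero_coefr X K P (iX : {linear K -> P}) (gX : {linear P -> X}) :
  ses iX gX -> projective_module P ->
  ext1_zero X N -> ext1_zero K N' -> ext1_zero X N''.
Proof.
move=> sX pP eX eK; have [ii sg eg] := s.
apply: (ext1_zero_cover sX pP) => u.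
have [K2 [P1 [i1 [g1 [s1 pP1]]]]] := proj_cover K.
have [_ sg1 eg1] := s1.
have [w wE] := pP1 _ _ g (u \o g1) sg; have {}wE x : g (w x) = u (g1 x) by exact: wE.
have [|t tE] := inj_lift_ex (w := w \o i1) ii.
  by move=> k /=; apply/eg; rewrite wE (exact0 eg1) linear0.
have [v vE] := eK _ _ _ _ s1 t.
have [r rE] := comb_ex (-1) (i \o v) w.
have [|q qE] := @surj_factor_ex _ _ _ _ g1 r sg1.
  by move=> x /eg1[k <-]; rewrite rE /= vE tE /= scaleN1r addNr.
have [z zE] := eX _ _ _ _ sX q.
exists (g \o z) => k /=; have [x <-] := sg1 k.
by rewrite zE qE rE linearD linearZ /= (exact0 eg) scaler0 add0r wE.
Qed.

Lemma ext1_zero_coefl X K P (iX : {linear K -> P}) (gX : {linear P -> X}) :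
  ses iX gX -> projective_module P ->
  ext1_zero X N'' -> ext1_zero K N -> ext1_zero K N'.
Proof.
move=> sX pP eX eK; have [ii sg eg] := s.
have [K2 [P1 [i1 [g1 [s1 pP1]]]]] := proj_cover K.
have [_ sg1 eg1] := s1.
apply: (ext1_zero_cover s1 pP1) => u.
have [v vE] := eK _ _ _ _ s1 (i \o u).
have [|t tE] := @surj_factor_ex _ _ _ _ g1 (g \o v) sg1.
  by move=> x /eg1[k <-] /=; rewrite vE /= (exact0 eg).
have [w wE] := eX _ _ _ _ sX t.
have [w' w'E] := pP _ _ g w sg; have {}w'E x : g (w' x) = w x by exact: w'E.
have [r rE] := comb_ex (-1) (w' \o iX \o g1) v.
have [|z zE] := inj_lift_ex (w := r) ii.
  by move=> x; apply/eg; rewrite rE linearD linearZ /= w'E wE tE /= scaleN1r addNr.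
exists z => k; apply: ii; rewrite zE rE /= vE /= (exact0 eg1) !linear0.
by rewrite add0r.
Qed.

Lemma ext_zero_coefr n X :
  ext_zero n.+1 X N -> ext_zero n.+2 X N' -> ext_zero n.+1 X N''.
Proof. exact: (ext1_zero_coefr (std_ses (std_syz X n)) (@freeg_projective _ _)). Qed.

Lemma ext_zero_coefl n X :
  ext_zero n.+1 X N'' -> ext_zero n.+2 X N -> ext_zero n.+2 X N'.
Proof. exact: (ext1_zero_coefl (std_ses (std_syz X n)) (@freeg_projective _ _)). Qed.

End Coefficients.

(** Dimension shifting: the image [C] of [d 0] is the cokernel of [e] and has a shorter injective
    resolution. At length 0 the map [e] is an isomorphism. *)
Lemma finite_id_ext_zero N : finite_id N ->
  exists n, forall X j, (n < j)%N -> ext_zero j X N.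
Proof.
move=> [n [E [d [e H]]]]; exists n; move: N E d e H.
elim: n => [|n IH] N E d e [iE ie ee ed zE] X [//|j] jn.
  have se : surjective e by move=> y; apply/ee; apply: zE.
  rewrite /ext_zero; move: (std_syz X j) => Z K L i g [ii _ _] u.
  have [v vE] := iE 0 _ _ i (e \o u) ii.
  have [w wE] := inj_lift_ex (w := v) ie (fun x => se (v x)).
  by exists w => x; apply: ie; rewrite wE; apply: vE.
have [C [h [k [sh ik kh]]]] := im_ses (d 0).
have sC : ses e h.
  split=> // y; rewrite -ee -kh; split=> [->|hy]; first exact: linear0.
  by apply: ik; rewrite linear0.
case: j jn => [//|j] jn; apply: (ext_zero_coefl sC).
  apply: (IH C (fun i => E i.+1) (fun i => d i.+1) k) => //; split=> [i||y|i|i ni].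
  - exact: iE.
  - by [].
  - split=> [/ed[x xy]|[x <-]]; first by exists (h x); rewrite kh.
    by have [z <-] := sh x; rewrite kh (exact0 (ed 0)).
  - exact: ed.
  exact: zE.
rewrite /ext_zero; move: (std_syz X j.+1) => Z K L i g [ii _ _] u.
by have [v vE] := iE 0 _ _ i u ii; exists v => x; apply: vE.
Qed.

Lemma finite_pd_ext_zero V : finite_pd V ->
  exists n, forall N j, (n < j)%N -> ext_zero j V N.
Proof.
move=> [n [P [d [e H]]]]; exists n; move: V P d e H.
elim: n => [|n IH] V P d e [pP se ee ed zP] N [//|j] jn.
  have [|f fE] := @surj_factor_ex _ _ _ _ e idfun se.
    by move=> x /ee[y <-]; rewrite (zP 1 _ y) // linear0.
  apply: (@ext_zero_retract _ _ _ (P 0)); last exact: ext_zero_projective.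
  apply: (stable_retract_split (f := f) (g := e)) => x.
  by have [y <-] := se x; rewrite fE scale1r.
have [C [h [k [sh ik kh]]]] := im_ses (d 0).
have sC : ses k e.
  split=> // y; rewrite (ee y); split=> -[x <-]; first by exists (h x); rewrite kh.
  by have [z <-] := sh x; exists z; rewrite kh.
case: j jn => [//|j] jn; apply/(ext_zero_syz j N sC (pP 0)).
apply: (IH C (fun i => P i.+1) (fun i => d i.+1) h) => //; split=> [i||y|i|i ni].
- exact: pP.
- by [].
- rewrite -ed -kh; split=> [->|hy]; first exact: linear0.
  by apply: ik; rewrite linear0.
- exact: ed.
exact: zP.
Qed.

(** Multiplication by [c] on H factors through the zero module, and this passes to syzygies; hence
    [c] annihilates Ext(H, -) in positive degrees. *)
Lemma killed_retract c H n : (forall h : H, c *: h = 0) ->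
  stable_retract c (std_syz H n) (std_syz 'rV[R]_0 n).
Proof.
move=> cH; elim: n => [|n IH].
  exists \0, \0, 'rV[R]_0, \0, \0; split; first exact: row_projective.
  by move=> x; rewrite cH addr0.
exact: (stable_retract_ker (std_ses _) (@freeg_projective _ _) (std_ses _) (@freeg_projective _ _)).
Qed.

(** Here [N'] is N/xN. Vanishing of Ext^n(H, N') makes x injective on Ext^(n+1)(H, N), where x^l
    acts as zero. *)
Lemma ext_zero_nilpotent n H N N' (x : R) l (i : {linear N -> N}) (g : {linear N -> N'}) :
  ses i g -> (forall y, i y = x *: y) -> (forall h : H, x ^+ l *: h = 0) ->
  ext_zero n H N' -> ext_zero n.+1 H N.
Proof.
move=> s iE xH eN'; rewrite /ext_zero.
have [ii sg eg] := s.
have [K [P [iX [gX [sX pP]]]]] := proj_cover (std_syz H n).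
have kill : forall u : {linear K -> N}, exists v : {linear P -> N},
    forall k, v (iX k) = x ^+ l *: u k.
  move=> u; apply: (stable_retract_ext1 (killed_retract n xH) _ sX pP).
  exact: (@ext_zero_projective R n _ N (@row_projective R 0)).
(* Injectivity of x on Ext: if [x *: u] extends to [P], so does [u]. It is applied [l] times. *)
suff step (u : {linear K -> N}) (v : {linear P -> N}) :
    (forall k, v (iX k) = x *: u k) ->
    exists v : {linear P -> N}, forall k, v (iX k) = u k.
  apply: (ext1_zero_cover sX pP) => u; have := kill u; move: {kill}l {xH}u.
  elim=> [|l IH] u [v vE]; first by exists v => k; rewrite vE scale1r.
  apply: IH; have [u' u'E] := comb_ex (x ^+ l) u \0.
  have [|v' v'E] := step u' v.
    by move=> k; rewrite vE u'E addr0 scalerA -exprS.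
  by exists v' => k; rewrite v'E u'E addr0.
move=> vE; have [_ sgX egX] := sX.
have [|w wE] := @surj_factor_ex _ _ _ _ gX (g \o v) sgX.
  by move=> p /egX[k <-] /=; rewrite vE; apply/eg; exists (u k); rewrite iE.
(* [w] represents a class in Ext^n(H, N'), which is zero. This gives a [t] that agrees with [v]
   modulo xN and vanishes on [K], so that [v - t] is divisible by x. *)
have [t [tE tk]] : exists t : {linear P -> N},
    (forall p, g (t p) = g (v p)) /\ forall k, t (iX k) = 0.
  case: n eN' gX sX sgX egX w wE {kill} => [|n] eN' gX sX sgX egX w wE.
    by exists \0; split=> // p /=; rewrite linear0 -[RHS]/((g \o v) p) -wE eN'.
  have [r rE] := eN' _ _ _ _ (std_ses (std_syz H n)) w.
  have [r' r'E] := (@freeg_projective _ _) _ _ g r sg.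
  have {}r'E y : g (r' y) = r y by exact: r'E.
  exists (r' \o val \o gX); split=> p /=.
    by rewrite r'E rE wE.
  by rewrite (exact0 egX) linear0.
have [z zE] := comb_ex (-1) t v.
have [|v' v'E] := inj_lift_ex (w := z) ii.
  by move=> p; apply/eg; rewrite zE linearD linearZ /= tE scaleN1r addNr.
exists v' => k; apply: ii.
by rewrite v'E zE tk scaler0 add0r vE iE.
Qed.

End Covariant.

(** * Finitely generated modules over a Noetherian ring *)

Section FiniteGeneration.
Variable R : comNzRingType.
Implicit Types A B C K L P Q V X Y N W M : lmodType R.

Lemma fgP V : finitely_generated V <->
  exists n (g : {linear 'rV[R]_n -> V}), surjective g.
Proof.
split=> [[n [g gE]]|[n [g sg]]].
  have [h hE] : exists h : {linear 'rV[R]_n -> V}, forall x, h x = \sum_i x 0 i *: g i.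
    apply: linear_ex => a x y; rewrite scaler_sumr -big_split /=.
    by apply: eq_bigr => i _; rewrite !mxE scalerDl scalerA.
  exists n, h => v; have [c ->] := gE v.
  by exists (\row_i c i); rewrite hE; apply: eq_bigr => i _; rewrite mxE.
exists n, (fun i => g (delta_mx 0 i)) => v; have [x <-] := sg v.
exists (fun i => x 0 i); rewrite [in LHS](row_sum_delta x) linear_sum.
by apply: eq_bigr => i _; rewrite linearZ.
Qed.

Lemma fg_surj V W (g : {linear V -> W}) : surjective g ->
  finitely_generated V -> finitely_generated W.
Proof.
move=> sg [n [h hE]]; exists n, (fun i => g (h i)) => w; have [v <-] := sg w.
have [c ->] := hE v; exists c; rewrite linear_sum.
by apply: eq_bigr => i _; rewrite linearZ.
Qed.

Lemma fg_row n : finitely_generated 'rV[R]_n.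
Proof. by apply/fgP; exists n, idfun => x; exists x. Qed.

Lemma fg_ses A B C (i : {linear A -> B}) (g : {linear B -> C}) :
  ses i g -> finitely_generated A -> finitely_generated C -> finitely_generated B.
Proof.
move=> [ii sg eg] /fgP[n [a sa]] /fgP[m [c sc]]; apply/fgP.
have [b bE] := @row_projective R m _ _ g c sg.
pose h : {linear 'rV[R]_(n + m) -> B} := (i \o (a \o lsubmx)) \+ (b \o rsubmx).
exists (n + m)%N, h => y; have [z zE] := sc (g y).
have /eg[k kE] : g (y - b z) = 0.
  by rewrite linearB; move: (bE z) => /= ->; rewrite zE subrr.
have [x xE] := sa k; exists (row_mx x z).
by rewrite /h /= row_mxKl row_mxKr xE kE subrK.
Qed.

Definition pow n M : lmodType R := ('I_n -> M).

Lemma pow_ses n M : exists (i : {linear M -> pow n.+1 M}) (g : {linear pow n.+1 M -> pow n M}),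
  ses i g.
Proof.
have [i iE] : exists i : {linear M -> pow n.+1 M},
    forall m, i m = fun k => if k == ord0 then m else 0.
  apply: linear_ex => a x y; apply/funext => k; rewrite addrfctE scalrfctE.
  by case: eqP => // _; rewrite scaler0 addr0.
have [g gE] : exists g : {linear pow n.+1 M -> pow n M},
    forall z, g z = fun k => (z : 'I_n.+1 -> M) (fintype.lift ord0 k).
  by apply: linear_ex => a x y; apply/funext => k.
exists i, g; split=> [x y|y|z].
- by rewrite !iE => /(congr1 (fun f : 'I_n.+1 -> M => f ord0)).
- exists (fun k => if unlift ord0 k is Some j then (y : 'I_n -> M) j else 0).
  by rewrite gE; apply/funext => k; rewrite liftK.
rewrite gE; split=> [e|[x <-]]; last first.
  by rewrite iE; apply/funext => k; rewrite eq_sym (negPf (neq_lift _ _)).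
exists ((z : 'I_n.+1 -> M) ord0); rewrite iE; apply/funext => k; case: eqP => [->//|/eqP].
case: (unliftP ord0 k) => [j ->|->]; last by rewrite eqxx.
by move=> _; have := congr1 (fun f : 'I_n -> M => f j) e.
Qed.

Lemma pow0_zero M : is_zero (pow 0 M).
Proof. by move=> x; apply/funext; case. Qed.

Lemma is_zero_projective V : is_zero V -> projective_module V.
Proof. by move=> z X Y g f _; exists \0 => x /=; rewrite (z x) !linear0. Qed.

Lemma fg_pow n M : finitely_generated M -> finitely_generated (pow n M).
Proof.
move=> fM; elim: n => [|n IH].
  exists 0, (fun=> 0) => x; exists (fun=> 0); rewrite big_ord0; exact: pow0_zero.
by have [i [g s]] := pow_ses n M; apply: fg_ses s fM IH.
Qed.

Lemma ext_zero_pow n j M N : ext_zero j.+1 M N -> ext_zero j.+1 (pow n M) N.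
Proof.
move=> eM; elim: n => [|n IH].
  exact: (@ext_zero_projective _ j _ N (is_zero_projective (@pow0_zero M))).
by have [i [g s]] := pow_ses n M; apply: (ext_zero_sesm s).
Qed.

Definition noetherian_module V : Prop :=
  forall A (i : {linear A -> V}), injective i -> finitely_generated A.

Lemma noetherian_module_ses A B C (i : {linear A -> B}) (g : {linear B -> C}) :
  ses i g -> noetherian_module A -> noetherian_module C -> noetherian_module B.
Proof.
move=> [ii sg eg] nA nC X f jf.
have [Y [h [k [sh ik kh]]]] := im_ses (g \o f).
have [K [i' s']] := ker_ses sh; have [ii' _ eh] := s'.
apply: (fg_ses s'); last exact: nC ik.
have [|f' f'E] := @inj_lift_ex _ _ _ _ i (f \o i') ii.
  by move=> x; apply/eg; rewrite -[LHS]/((g \o f) (i' x)) -kh (exact0 eh) linear0.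
apply: (nA _ f') => x y e; apply/ii'/jf.
by move: (f'E x) (f'E y) => /= <- <-; rewrite e.
Qed.

Lemma noetherian_module_surj V W (g : {linear V -> W}) :
  surjective g -> noetherian_module V -> noetherian_module W.
Proof.
move=> sg nV A i ii.
have [C [h [sh eh]]] := coker_ex i.
have [K [j [ij sj ej]]] := ker_ses (comp_surj sg sh).
have [|q qE] := @inj_lift_ex _ _ _ _ i (g \o j) ii.
  by move=> x; apply/eh; exact: (exact0 ej).
apply: (@fg_surj K _ q); last exact: nV ij.
move=> a; have [v vE] := sg (i a).
have /ej[k kE] : (h \o g) v = 0 by rewrite /= vE (exact0 eh).
by exists k; apply: ii; rewrite qE /= kE.
Qed.

Hypothesis noeth : noetherian R.

Lemma noetherian_fg V : finitely_generated V -> noetherian_module V.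
Proof.
move=> [n [g gE]].
have nR : noetherian_module R^o.
  move=> A i ii; have := noeth (immod i).
  have [|q qE] := @inj_lift_ex _ _ _ _ i (val : {linear submod (immod i) -> R^o}) ii.
    by move=> x; have := valP x; rewrite unfold_in => /asboolP.
  apply: (@fg_surj _ _ q) => a.
  have ia : i a \in immod i by rewrite unfold_in; apply/asboolP; exists a.
  by exists (exist (fun y => y \in immod i) _ ia); apply: ii; rewrite qE.
have np : noetherian_module (pow n R^o).
  elim: (n) => [|k IH]; last by have [i [h s]] := pow_ses k R^o; exact: noetherian_module_ses s nR IH.
  move=> A i ii; exists 0, (fun=> 0) => x; exists (fun=> 0).
  by apply: ii; rewrite [LHS]pow0_zero [RHS]pow0_zero.
have [h hE] : exists h : {linear pow n R^o -> V}, forall z, h z = \sum_i (z : 'I_n -> R) i *: g i.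
  apply: linear_ex => a x y; rewrite scaler_sumr -big_split /=.
  by apply: eq_bigr => i _; rewrite addrfctE scalrfctE scalerDl scalerA.
apply: (@noetherian_module_surj _ _ h) np => v.
by have [c ->] := gE v; exists c; rewrite hE.
Qed.

Lemma fg_inj A B (i : {linear A -> B}) :
  injective i -> finitely_generated B -> finitely_generated A.
Proof. by move=> ii fB; apply: noetherian_fg fB _ _ ii. Qed.

(** Evaluation at generators of A embeds Hom(A, N) into a power of N. *)
Lemma fg_hom A N : finitely_generated A -> finitely_generated N ->
  finitely_generated (Hom_mod A N).
Proof.
move=> [n [g gE]] fN.
have [ev evE] : exists ev : {linear Hom_mod A N -> pow n N},
    forall h, ev h = fun i => val h (g i).
  by apply: linear_ex => a x y; apply/funext => i.
apply: (@fg_inj _ _ ev); last exact: fg_pow.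
move=> h h'; rewrite !evE => e; apply/val_inj/funext => a.
have [c ->] := gE a.
have lh (f : Hom_mod A N) : val f (\sum_i c i *: g i) = \sum_i c i *: val f (g i).
  rewrite -[LHS]/(mklin (hom_linear f) _) linear_sum.
  by apply: eq_bigr => i _; rewrite linearZ.
by rewrite !lh; apply: eq_bigr => i _; rewrite (congr1 (fun f : 'I_n -> N => f i) e).
Qed.

Lemma fg_cover V : finitely_generated V ->
  exists n K (i : {linear K -> 'rV[R]_n}) (g : {linear 'rV[R]_n -> V}),
    ses i g /\ finitely_generated K.
Proof.
move=> /fgP[n [g sg]]; have [K [i s]] := ker_ses sg.
by exists n, K, i, g; split=> //; have [ii _ _] := s; apply: fg_inj ii (fg_row n).
Qed.

End FiniteGeneration.

(** * Ideals and Nakayama's lemma *)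

Section Ideals.
Variable R : comNzRingType.
Implicit Types I J : R -> Prop.

(** Unlike [idealr], this admits the unit ideal, so that sums and colon ideals always qualify. *)
Definition ideal I : Prop := I 0 /\ forall a x y, I x -> I y -> I (a * x + y).

Lemma idealM I a x : ideal I -> I x -> I (a * x).
Proof. by move=> [I0 h] Ix; rewrite -[_ * _]addr0; apply: h. Qed.

Lemma idealD I x y : ideal I -> I x -> I y -> I (x + y).
Proof. by move=> [I0 h] Ix Iy; rewrite -[x]mul1r; apply: h. Qed.

Lemma ideal_sum I n (F : 'I_n -> R) : ideal I -> (forall i, I (F i)) -> I (\sum_i F i).
Proof.
move=> iI IF; elim/big_ind: _ => //; first by case: iI.
by move=> x y; exact: idealD.
Qed.

Lemma submod_of_ideal I : ideal I -> exists S : submodClosed R^o, forall x : R, x \in S <-> I x.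
Proof.
move=> [I0 h]; pose p : {pred R^o} := fun x => `[< I x >].
have pc : submod_closed p.
  split=> [|a x y]; rewrite !unfold_in; first exact/asboolP.
  by move=> /asboolP Ix /asboolP Iy; apply/asboolP/h.
pose S : submodClosed R^o := HB.pack p (GRing.isSubmodClosed.Build R R^o p pc).
by exists S => x; rewrite unfold_in; split=> [/asboolP|?] //; apply/asboolP.
Qed.

Lemma idealr_of_ideal I : ideal I -> ~ I 1 -> exists p : idealr R, forall x, x \in p <-> I x.
Proof.
move=> [I0 h] I1; pose p : {pred R} := fun x => `[< I x >].
have pc : idealr_closed p.
  split=> [||a x y]; rewrite ?unfold_in; [exact/asboolP | exact/asboolPn|].
  by move=> /asboolP Ix /asboolP Iy; apply/asboolP/h.
pose S : idealr R := HB.pack (p : R -> bool) (isIdealr.Build R p pc).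
by exists S => x; rewrite unfold_in; split=> [/asboolP|?] //; apply/asboolP.
Qed.

Lemma prime_of_ideal I : ideal I -> ~ I 1 -> (forall a b, I (a * b) -> I a \/ I b) ->
  exists p : prime_idealr R, forall x, x \in p <-> I x.
Proof.
move=> [I0 h] I1 pI; pose p : {pred R} := fun x => `[< I x >].
have pc : idealr_closed p.
  split=> [||a x y]; rewrite ?unfold_in; [exact/asboolP | exact/asboolPn|].
  by move=> /asboolP Ix /asboolP Iy; apply/asboolP/h.
have pp : prime_idealr_closed p.
  move=> u v; rewrite !unfold_in => /asboolP/pI[] ?; apply/orP; [left|right]; exact/asboolP.
pose S : prime_idealr R := HB.pack (p : R -> bool) (isIdealr.Build R p pc)
  (isPrimeIdealrClosed.Build R p pp).
by exists S => x; rewrite unfold_in; split=> [/asboolP|?] //; apply/asboolP.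
Qed.

Lemma ideal_of_idealr (p : idealr R) : ideal (fun x => x \in p).
Proof.
split=> [|a x y px py]; first exact: idealr0.
by apply: (rpredD (S := p)) => //; apply: idealMr.
Qed.

Lemma ideal_add I (b : R) : ideal I -> ideal (fun x => exists r y, I y /\ x = r * b + y).
Proof.
move=> iI; split=> [|a x y [r [z [Iz ->]]] [r' [z' [Iz' ->]]]].
  by exists 0, 0; split; [case: iI | rewrite mul0r addr0].
exists (a * r + r'), (a * z + z'); split; first by case: iI => _; apply.
by rewrite mulrDr mulrDl !mulrA addrACA.
Qed.

Lemma ideal_colon I (b : R) : ideal I -> ideal (fun x => I (x * b)).
Proof.
move=> iI; split=> [|a x y Ix Iy]; first by rewrite mul0r; case: iI.
by rewrite mulrDl -mulrA; case: iI => _; apply.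
Qed.

Hypothesis noeth : noetherian R.

(** Without a maximal member, choice yields a strictly increasing sequence of ideals; its union is
    finitely generated, so it is reached at a finite stage. *)
Lemma ideal_maximal_ex (F : (R -> Prop) -> Prop) :
  (exists I, ideal I /\ F I) ->
  exists I, [/\ ideal I, F I & forall J, ideal J -> F J ->
    (forall x, I x -> J x) -> forall x, J x -> I x].
Proof.
move=> [I0 [iI0 FI0]]; apply: contrapT => nomax.
pose T := {I : R -> Prop | ideal I /\ F I}.
have /choice[nxt nxtP] (I : T) : exists J : T,
    (forall x, sval I x -> sval J x) /\ exists x, sval J x /\ ~ sval I x.
  case: I => I [iI FI]; apply: contrapT => nJ; apply: nomax; exists I; split=> // J iJ FJ IJ x Jx.
  apply: contrapT => nIx; apply: nJ; exists (exist _ J (conj iJ FJ)).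
  by split=> //; exists x.
pose c n := iter n nxt (exist _ I0 (conj iI0 FI0)).
have cle n k : (n <= k)%N -> forall x, sval (c n) x -> sval (c k) x.
  move=> /subnK <-; elim: (k - n)%N => // l IH x /IH.
  by rewrite addSn /c iterS; apply: (nxtP _).1.
have cid n : ideal (sval (c n)) by case: (c n) => I [].
pose U x := exists n, sval (c n) x.
have iU : ideal U.
  split=> [|a x y [n nx] [k ky]]; first by exists 0; case: (cid 0).
  exists (maxn n k); case: (cid (maxn n k)) => _; apply.
    by apply: cle nx; apply: leq_maxl.
  by apply: cle ky; apply: leq_maxr.
have [S SE] := submod_of_ideal iU.
have [n [g gE]] := noeth S.
have /choice[r rE] (i : 'I_n) : exists k, sval (c k) (val (g i)) by apply/SE; apply: (valP (g i)).
pose N := \max_i r i.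
have UN x : U x -> sval (c N) x.
  move=> /SE xS; have [d dE] := gE (exist (fun x => x \in S) x xS).
  have -> : x = \sum_i d i * val (g i).
    have := congr1 val dE; rewrite /= => ->.
    rewrite -[LHS]/((val : {linear submod S -> R^o}) _) linear_sum.
    by apply: eq_bigr => i _.
  apply: ideal_sum => // i; apply: idealM => //.
  by apply: cle (rE i); apply: leq_bigmax.
have [_ [x [xN nx]]] := nxtP (c N).
by apply: nx; apply: UN; exists N.+1; rewrite /c iterS.
Qed.

Lemma noetherian_ideal_ind (Q : (R -> Prop) -> Prop) :
  (forall I, ideal I -> (forall J, ideal J -> (forall x, I x -> J x) ->
     (exists x, J x /\ ~ I x) -> Q J) -> Q I) ->
  forall I, ideal I -> Q I.
Proof.
move=> H I iI; apply: contrapT => nQ.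
have [|K [iK nK mK]] := @ideal_maximal_ex (fun J => ~ Q J); first by exists I.
apply: nK; apply: H => // J iJ KJ [x [Jx nKx]]; apply: contrapT => nQJ.
by apply: nKx; apply: mK Jx.
Qed.

Variable m : idealr R.
Hypothesis loc : local_ring m.

Lemma proper_ideal_sub I : ideal I -> ~ I 1 -> forall x, I x -> x \in m.
Proof.
move=> iI nI1 x Ix.
have [|K [iK [IK nK1] mK]] := @ideal_maximal_ex (fun J => (forall x, I x -> J x) /\ ~ J 1).
  by exists I.
have [p pE] := idealr_of_ideal iK nK1.
have mp : maximal_ideal p.
  move=> J pJ y; apply/idP/idP; last exact: pJ.
  move=> yJ; apply/pE; apply: (mK (fun x => x \in J)) => //.
  - exact: ideal_of_idealr.
  - by split=> [z /IK/pE/pJ //|]; rewrite idealr1.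
  by move=> z /pE/pJ.
by rewrite -(loc.2 p mp); apply/pE/IK.
Qed.

Lemma local_unit x : x \notin m -> exists y, y * x = 1.
Proof.
move=> xm; have i0 : ideal (fun y : R => y = 0).
  by split=> // a ? ? -> ->; rewrite mulr0 addr0.
have ix := ideal_add x i0; apply: contrapT => nx.
case/negP: xm; apply: (proper_ideal_sub ix).
  by move=> [r [y [-> e]]]; apply: nx; exists r; rewrite e addr0.
by exists 1, 0; rewrite mul1r addr0.
Qed.

Lemma local_unit1B c : c \in m -> exists u, u * (1 - c) = 1.
Proof.
move=> cm; apply: local_unit; apply/negP => h.
by have := rpredD h cm; rewrite subrK idealr1.
Qed.

End Ideals.

(** * Nakayama's lemma for modules and for Ext *)

Section Nakayama.
Variable R : comNzRingType.
Hypothesis noeth : noetherian R.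
Variable m : idealr R.
Hypothesis loc : local_ring m.
Implicit Types A B C K L P Q V X Y N W M : lmodType R.

Definition submodule V (S : V -> Prop) : Prop :=
  S 0 /\ forall a x y, S x -> S y -> S (a *: x + y).

(** Elimination of generators: [1 - c ord_max] is a unit, so modulo S the last generator is a
    combination of the others with coefficients in [m], and it is substituted into their
    relations. *)
Lemma nakayama_gen V (S : V -> Prop) n (g : 'I_n -> V) : submodule S ->
  (forall i, exists c : 'I_n -> R, (forall j, c j \in m) /\ S (g i - \sum_j c j *: g j)) ->
  forall i, S (g i).
Proof.
move=> [S0 SP].
have SD x y : S x -> S y -> S (x + y) by move=> ? ?; rewrite -[x]scale1r; apply: SP.
have SZ a x : S x -> S (a *: x) by move=> ?; rewrite -[_ *: _]addr0; apply: SP.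
elim: n g => [|n IH] g H; first by case.
pose w (i : 'I_n) := widen_ord (leqnSn n) i.
have [c [cm Sc]] := H ord_max.
have [u uE] := local_unit1B noeth loc (cm ord_max).
have Smax : S (g ord_max - \sum_j (u * c (w j)) *: g (w j)).
  have := SZ u _ Sc; congr S; rewrite big_ord_recr /=.
  have -> : \sum_j (u * c (w j)) *: g (w j) = u *: \sum_j c (w j) *: g (w j).
    by rewrite scaler_sumr; apply: eq_bigr => j _; rewrite scalerA.
  rewrite -[X in _ = X - _]scale1r -uE -scalerA -scalerBr scalerBl scale1r.
  by rewrite opprD addrA addrAC.
have Sw i : S (g (w i)).
  apply: (IH (g \o w)) => {}i /=.
  have [b [bm Sb]] := H (w i).
  exists (fun j => b (w j) + b ord_max * (u * c (w j))); split=> [j|].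
    apply: rpredD => //; rewrite mulrC; apply: idealMr => //.
  have := SD _ _ Sb (SZ (b ord_max) _ Smax).
  rewrite big_ord_recr /= scalerBr opprD -!addrA [- (b ord_max *: _) + _]addrA addNr add0r.
  rewrite scaler_sumr -opprD -big_split /=.
  by under eq_bigr do rewrite scalerA -scalerDl.
move=> i; have [->|[j ->]] : i = ord_max \/ exists j, i = w j.
- case: (unliftP ord_max i) => [j ->|->]; [right|by left].
  by exists j; apply/val_inj; rewrite /= /bump leqNgt ltn_ord.
- rewrite -[g ord_max](subrK (\sum_j (u * c (w j)) *: g (w j))); apply: (SD) => //.
  by apply: (big_ind S) => [||k _]; [| exact: SD | apply: SZ].
exact: Sw.
Qed.

Lemma nakayama V (S : V -> Prop) y : finitely_generated V -> submodule S -> y \in m ->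
  (forall v, exists v', S (v - y *: v')) -> forall v, S v.
Proof.
move=> [n [g gE]] sS ym H v.
have Sg i : S (g i).
  apply: (@nakayama_gen V S n g sS) => {}i; have [v' Sv] := H (g i); have [d dE] := gE v'.
  exists (fun j => y * d j); split=> [j|]; first by rewrite mulrC; apply: idealMr.
  by move: Sv; rewrite dE scaler_sumr; under eq_bigr do rewrite scalerA.
have [c ->] := gE v; case: sS => S0 SP.
apply: (big_ind S) => // [a b Sa Sb|i _]; first by rewrite -[a]scale1r; apply: SP.
by rewrite -[_ *: _]addr0; apply: SP.
Qed.

(** Nakayama's lemma for Hom(K, N) and the submodule of maps that extend to [P]; the quotient is
    Ext^1(A, N). *)
Lemma nakayama_ext1 A K P N (i : {linear K -> P}) (g : {linear P -> A}) y :
  ses i g -> projective_module P -> finitely_generated K -> finitely_generated N -> y \in m ->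
  (forall u : {linear K -> N}, exists (u' : {linear K -> N}) (v : {linear P -> N}),
     forall k, u k = y *: u' k + v (i k)) ->
  ext1_zero A N.
Proof.
move=> s pP fK fN ym H; apply: (ext1_zero_cover s pP) => u.
pose S (h : Hom_mod K N) := exists v : {linear P -> N}, forall x, v (i x) = val h x.
have sS : submodule S.
  split=> [|a h h' [v vE] [v' v'E]]; first by exists \0.
  by have [w wE] := comb_ex a v v'; exists w => x; rewrite wE vE v'E.
have [h hE] := hom_ex u.
have [|v vE] := @nakayama _ S y (fg_hom noeth fK fN) sS ym _ h.
  move=> f; have [u' [v E]] := H (mklin (hom_linear f)); have [f' f'E] := hom_ex u'.
  exists f', v => x; rewrite -[RHS]/(val f x - y *: val f' x) f'E.
  by rewrite -[val f x]/(mklin (hom_linear f) x) E addrC addKr.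
by exists v => x; rewrite vE hE.
Qed.

(* The syzygies of a cone of multiplication by y are again such a cone. *)
Lemma cone_syz K K' P Q K2 y (f : {linear K -> (K * P)%type})
    (q : {linear (K * P)%type -> K'}) (i : {linear K2 -> Q}) (p : {linear Q -> K}) :
  ses f q -> (forall k, (f k).1 = y *: k) -> ses i p ->
  projective_module P -> projective_module Q ->
  exists K2' Q' (i' : {linear K2' -> Q'}) (p' : {linear Q' -> K'})
    (f' : {linear K2 -> (K2 * Q)%type}) (q' : {linear (K2 * Q)%type -> K2'}),
  [/\ ses i' p', projective_module Q', ses f' q' & forall k, f' k = (y *: k, i k)].
Proof.
move=> [fi fs fe] f1 [ii sp ep] pP pQ.
have [r rE] := @pairing_ex R (Q * P)%type K P (p \o fst) snd.
have sq : surjective (q \o r).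
  by apply: comp_surj fs => -[k x]; have [z zk] := sp k; exists (z, x); rewrite rE /= zk.
have [K2' [i' s']] := ker_ses sq; have [ii' _ ei'] := s'.
exists K2', (Q * P)%type, i', (q \o r).
have [mu muE] := comb_ex y (idfun : {linear Q -> Q}) \0.
have [nu nuE] := comb_ex (-1) i \0.
have [t tE] := pair_ex nu mu.
(* The map (k, z) |-> (y z - i k, (f (p z)).2) lands in [K2'], because [r] sends the right-hand side
   to [f (p z)], which [q] kills. *)
have [t' t'E] := pairing_ex t (snd \o f \o p \o snd).
have tE' z : t' z = (y *: z.2 - i z.1, (f (p z.2)).2).
  by rewrite t'E tE /= muE nuE /= scaleN1r !addr0 addrC.
have [z | j jE] := @inj_lift_ex _ _ _ _ i' t' ii'.
  apply/ei'; rewrite /= rE tE' /= linearB linearZ /= (exact0 ep) subr0 -f1.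
  by rewrite -surjective_pairing (exact0 fe).
have [f' f'E0] := pairing_ex (y \*: (idfun : {linear K2 -> K2})) i.
have f'E k : f' k = (y *: k, i k) by exact: f'E0.
exists f', j; split=> //; first exact: prod_projective.
split=> [u v|z|z]; first by rewrite !f'E => -[_] /ii.
  have := exact0 ei' z; rewrite /= rE; case ez: (i' z) => [b x] /= => /fe[k] fk.
  have k1 := f1 k; rewrite fk /= in k1; have [c ck] := sp k.
  have /ep[k2 k2E] : p (y *: c - b) = 0 by rewrite linearB linearZ /= ck k1 subrr.
  exists (k2, c); apply: ii'.
  by rewrite jE tE' /= k2E ck fk ez /= opprB addrC subrK.
split=> [jz|[k <-]]; last first.
  by apply: ii'; rewrite jE tE' f'E /= linearZ /= subrr (exact0 ep) !linear0.
have := jE z; rewrite jz linear0 tE' => -[/esym e1 /esym e2].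
have yp : y *: p z.2 = 0.
  by have := congr1 p e1; rewrite linearB linearZ /= (exact0 ep) subr0 linear0.
have fp : f (p z.2) = 0 by rewrite (surjective_pairing (f _)) f1 yp e2.
have /ep[k kE] : p z.2 = 0 by apply: fi; rewrite fp linear0.
exists k; rewrite f'E kE [RHS]surjective_pairing; congr (_, _); apply: ii.
by rewrite linearZ /= kE; apply/eqP; rewrite -subr_eq0 e1.
Qed.

(** The vanishing for [K'] makes multiplication by y surjective on Ext^(n+1)(K, N), and Nakayama's
    lemma applies. The projective summand is carried along because syzygies create one. *)
Lemma ext_zero_cone n K K' P N y (f : {linear K -> (K * P)%type}) (q : {linear (K * P)%type -> K'}) :
  finitely_generated K -> projective_module P -> finitely_generated N -> y \in m ->
  ses f q -> (forall k, (f k).1 = y *: k) ->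
  ext_zero n.+2 K' N -> ext_zero n.+1 K N.
Proof.
move=> fK pP fN ym; elim: n K K' P f q fK pP => [|n IH] K K' P f q fK pP s f1 e'.
all: have [a [K2 [i [p [s2 fK2]]]]] := fg_cover noeth fK.
all: have pQ := @row_projective R a.
all: have [K2' [Q [i' [p' [f' [q' [s' pQ' s3 f'E]]]]]]] := cone_syz s f1 s2 pP pQ.
all: have {e'} := (ext_zero_syz _ N s' pQ').1 e'.
  move=> e1; apply: (nakayama_ext1 (y := y) s2 pQ) => // u.
  (* Splitting [v] along the two summands writes [u] as y times a map plus a map that extends to the
     free module. *)
  have [v vE] := e1 _ _ _ _ s3 u.
  have [v1 v1E] := pairing_ex (idfun : {linear K2 -> K2}) (\0 : {linear K2 -> 'rV[R]_a}).
  have [v2 v2E] := pairing_ex (\0 : {linear 'rV[R]_a -> K2}) (idfun : {linear 'rV[R]_a -> 'rV[R]_a}).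
  exists (v \o v1), (v \o v2) => k; rewrite -vE /= v1E v2E -linearZ -linearD /=; congr (v _).
  by rewrite f'E pairD /= addr0 [y *: 0]scaler0 add0r.
move=> e1; apply/(ext_zero_syz n N s2 pQ).
by apply: (IH _ _ _ _ _ fK2 pQ s3 _ e1) => k; rewrite f'E.
Qed.

Lemma ext_zero_regular n V V' N y (i : {linear V -> V}) (g : {linear V -> V'}) :
  ses i g -> (forall v, i v = y *: v) -> y \in m ->
  finitely_generated V -> finitely_generated N ->
  ext_zero n.+2 V' N -> ext_zero n.+1 V N.
Proof.
move=> [ii sg eg] iE ym fV fN.
have [f fE] := pairing_ex i (\0 : {linear V -> 'rV[R]_0}).
have z0 (x : 'rV[R]_0) : x = 0 by apply/rowP; case.
apply: (@ext_zero_cone n V V' 'rV[R]_0 N y f (g \o fst)) => //; first exact: row_projective.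
  split=> [u v|v|[v w]]; first by rewrite !fE => -[/ii].
    by have [x <-] := sg v; exists (x, 0).
  split=> [/eg[x xE]|[x]]; first by exists x; rewrite fE xE (z0 w).
  by rewrite fE => -[<- _] /=; rewrite (exact0 eg).
by move=> k; rewrite fE /= iE.
Qed.

(** Vanishing of Ext(X, V/yV) makes y surjective on Ext(X, V); Nakayama's lemma applies after
    reduction to degree one. *)
Lemma ext_zero_coef_regular n X V V' y (i : {linear V -> V}) (g : {linear V -> V'}) :
  ses i g -> (forall v, i v = y *: v) -> y \in m ->
  finitely_generated X -> finitely_generated V ->
  ext_zero n.+1 X V' -> ext_zero n.+1 X V.
Proof.
move=> s iE ym; have [ii sg eg] := s.
elim: n X => [|n IH] X fX fV; have [a [K [j [p [sX fK]]]]] := fg_cover noeth fX; last first.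
  move=> /(ext_zero_syz n _ sX (@row_projective R a)) e.
  by apply/(ext_zero_syz n _ sX (@row_projective R a)); apply: IH.
move=> e; apply: (nakayama_ext1 (y := y) sX (@row_projective R a)) => // u.
have [w wE] := e _ _ _ _ sX (g \o u).
have [w' w'E] := @row_projective R a _ _ g w sg; have {}w'E x : g (w' x) = w x by exact: w'E.
have [t tE] := comb_ex (-1) (w' \o j) u.
have [|u' u'E] := @inj_lift_ex _ _ _ _ i t ii.
  by move=> x; apply/eg; rewrite tE linearD linearZ /= w'E wE /= scaleN1r addNr.
by exists u', w' => k; rewrite -iE u'E tE /= scaleN1r addrAC addNr add0r.
Qed.

End Nakayama.

(** * Devissage and regular sequences *)

Section Cyclic.
Variable R : comNzRingType.
Implicit Types A B C K L P Q V X Y N W M : lmodType R.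
Implicit Types I J : R -> Prop.

Definition generates V (v : V) : Prop := forall w, exists r : R, w = r *: v.

(** V is R/I with [v] the class of 1, without a chosen model of R/I. *)
Definition cyclic_module V (v : V) I : Prop :=
  generates v /\ forall r : R, r *: v = 0 <-> I r.

Lemma orbit_ex V (v : V) : exists f : {linear R^o -> V}, forall r, f r = (r : R) *: v.
Proof. by apply: linear_ex => a x y; rewrite scalerDl -scalerA. Qed.

Lemma annihilator_ideal V (v : V) : ideal (fun r : R => r *: v = 0).
Proof.
by split=> [|a x y xv yv]; rewrite ?scale0r // scalerDl -scalerA xv yv scaler0 addr0.
Qed.

Lemma sub_generated V (x : V) : exists A C (i : {linear A -> V}) (g : {linear V -> C}) (a : A),
  [/\ ses i g, i a = x & generates a].
Proof.
have [f fE] := orbit_ex x.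
have [A [h [j [sh ij jh]]]] := im_ses f.
have [C [g s]] := coker_ses ij.
exists A, C, j, g, (h (1 : R^o)); split=> //; first by rewrite jh fE scale1r.
move=> w; have [r <-] := sh w; exists r; apply: ij.
by rewrite linearZ /= !jh !fE scale1r.
Qed.

Lemma cyclic_map V W (v : V) (w : W) : generates v -> generates w ->
  (forall r : R, r *: v = 0 -> r *: w = 0) -> exists f : {linear V -> W}, f v = w /\ surjective f.
Proof.
move=> gv gw vw; have [f fE] := orbit_ex v; have [h hE] := orbit_ex w.
have [|x|g gE] := @surj_factor_ex _ _ _ _ f h.
- by move=> y; have [r ->] := gv y; exists r; rewrite fE.
- by rewrite fE hE; exact: vw.
have gvw : g v = w by rewrite -[v]scale1r -(fE 1) gE hE scale1r.
exists g; split=> // y; have [r ->] := gw y.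
by exists (r *: v); rewrite linearZ /= gvw.
Qed.

Lemma linear_inj A B (f : {linear A -> B}) : (forall x, f x = 0 -> x = 0) -> injective f.
Proof.
move=> H x y e; apply/eqP; rewrite -subr_eq0; apply/eqP/H.
by rewrite linearB e subrr.
Qed.

Lemma scale_ex V (y : R) : exists f : {linear V -> V}, forall v, f v = y *: v.
Proof.
have [f fE] := comb_ex y (idfun : {linear V -> V}) \0.
by exists f => v; rewrite fE addr0.
Qed.

Lemma cyclic_quot V C (v : V) I b (g : {linear V -> C}) : cyclic_module v I -> surjective g ->
  (forall x, g x = 0 <-> exists r : R, x = (r * b) *: v) ->
  cyclic_module (g v) (fun x => exists r y, I y /\ x = r * b + y).
Proof.
move=> [gv av] sg gk; split=> [w|r].
  have [x <-] := sg w; have [r ->] := gv x.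
  by exists r; rewrite linearZ.
rewrite -[r *: g v]/(( *:%R) r (g v)) -linearZ gk; split=> -[t].
  move=> e; exists t, (r - t * b); split; last by rewrite addrC subrK.
  by apply/av; rewrite scalerBl e subrr.
by move=> [y [/av yv ->]]; exists t; rewrite scalerDl yv addr0.
Qed.

Section Devissage.
Hypothesis noeth : noetherian R.
Variable m : idealr R.
Hypothesis loc : local_ring m.

(** Induction on the number of generators reduces to cyclic modules R/I, which are treated by
    Noetherian induction on I. *)
Lemma devissage (Q : lmodType R -> Prop) :
  (forall V, is_zero V -> Q V) ->
  (forall A B C (i : {linear A -> B}) (g : {linear B -> C}), ses i g -> Q A -> Q C -> Q B) ->
  (forall V (v : V), cyclic_module v (fun r => r \in m) -> Q V) ->
  (forall V V' y (i : {linear V -> V}) (g : {linear V -> V'}), ses i g ->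
     (forall v, i v = y *: v) -> y \in m -> finitely_generated V -> Q V' -> Q V) ->
  forall V, finitely_generated V -> Q V.
Proof.
move=> Q0 Qext Qk Qreg.
have Qcyc : forall I, ideal I -> forall V (v : V), cyclic_module v I -> Q V.
  apply: (noetherian_ideal_ind noeth) => I iI IH V v cv; have [gv av] := cv.
  have [I1|nI1] := pselect (I 1).
    apply: Q0 => x; have [r ->] := gv x.
    have v0 : v = 0 by rewrite -[v]scale1r; apply/av.
    by rewrite v0 scaler0.
  (* If I is not prime, 0 -> R/(I : b) -> R/I -> R/(I + b) -> 0 has strictly larger ideals at both
     ends. *)
  have [[a [b [Iab na nb]]]|pI] :=
      pselect (exists a b, [/\ I (a * b), ~ I a & ~ I b]).
    have [A [C [i [g [x [s ix gx]]]]]] := sub_generated (b *: v).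
    have [ii sg eg] := s.
    apply: (Qext _ _ _ _ _ s).
      apply: (IH _ (ideal_colon b iI) _ _ A x) => [y Iy||].
      - by rewrite mulrC; apply: idealM.
      - by exists a.
      split=> // r; split=> h.
        by apply/av; rewrite -scalerA -ix -linearZ h linear0.
      by apply: ii; rewrite linearZ /= ix scalerA linear0; apply/av.
    apply: (IH _ (ideal_add b iI) _ _ C (g v)) => [y Iy||].
    - by exists 0, y; rewrite mul0r add0r.
    - by exists b; split=> //; exists 1, 0; rewrite mul1r addr0; split=> //; case: iI.
    apply: cyclic_quot => // y; rewrite (eg y); split=> -[z].
      by move=> <-; have [r ->] := gx z; exists r; rewrite linearZ /= ix scalerA.
    by move=> ->; exists (z *: x); rewrite linearZ /= ix scalerA.
  have [mI|] := pselect (forall y, y \in m -> I y).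
    apply: (Qk _ v); split=> // r; rewrite av; split; last exact: mI.
    exact: (proper_ideal_sub noeth loc iI nI1).
  (* Now I is prime and [y] lies in [m] but not in I, so y is regular on R/I, with quotient R/(I +
     y). *)
  move=> /existsNP[y /not_implyP[ym nIy]].
  have [i iE] := scale_ex V y.
  have ii : injective i.
    apply: linear_inj => x; have [r ->] := gv x; rewrite iE scalerA => /av yr.
    by apply/av; apply: contrapT => nr; apply: pI; exists y, r.
  have [C [g s]] := coker_ses ii; have [_ sg eg] := s.
  apply: (Qreg _ _ _ _ _ s iE ym).
    by exists 1%N, (fun=> v) => w; have [r ->] := gv w; exists (fun=> r); rewrite big_ord1.
  apply: (IH _ (ideal_add y iI) _ _ C (g v)) => [x Ix||].
  - by exists 0, x; rewrite mul0r add0r.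
  - by exists y; split=> //; exists 1, 0; rewrite mul1r addr0; split=> //; case: iI.
  apply: cyclic_quot => // x; rewrite (eg x); split=> -[z].
    by move=> <-; have [r ->] := gv z; exists r; rewrite iE scalerA mulrC.
  by move=> ->; exists (z *: v); rewrite iE scalerA mulrC.
move=> V [n [g gE]]; elim: n V g gE => [|n IH] V g gE.
  by apply: Q0 => x; have [c ->] := gE x; rewrite big_ord0.
have [A [C [i [h [x [s ix gx]]]]]] := sub_generated (g ord0).
have [ii sh eh] := s.
apply: (Qext _ _ _ _ _ s).
  by apply: (Qcyc _ (annihilator_ideal x) A x).
apply: (IH C (fun k => h (g (fintype.lift ord0 k)))) => z; have [w <-] := sh z.
have [c ->] := gE w; exists (fun k => c (fintype.lift ord0 k)).
rewrite big_ord_recl linearD linearZ /= -ix (exact0 eh) scaler0 add0r linear_sum.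
by apply: eq_bigr => k _; rewrite linearZ.
Qed.

(** Dividing by one generator leaves a nonzero module unless V is cyclic; in that case the
    annihilator of the generator is proper, hence inside [m]. *)
Lemma surj_residue V W (w : W) : finitely_generated V -> ~ is_zero V ->
  cyclic_module w (fun r => r \in m) -> exists f : {linear V -> W}, surjective f.
Proof.
move=> [n [g gE]] nV [gw aw]; elim: n V g gE nV => [|n IH] V g gE nV.
  by case: nV => x; have [c ->] := gE x; rewrite big_ord0.
have [A [C [i [h [x [s ix gx]]]]]] := sub_generated (g ord0).
have [ii sh eh] := s.
have [C0|nC] := pselect (is_zero C); last first.
  have [|f sf] := IH C (fun k => h (g (fintype.lift ord0 k))) _ nC.
    move=> z; have [t <-] := sh z.
    have [c ->] := gE t; exists (fun k => c (fintype.lift ord0 k)).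
    rewrite big_ord_recl linearD linearZ /= -ix (exact0 eh) scaler0 add0r linear_sum.
    by apply: eq_bigr => k _; rewrite linearZ.
  by exists (f \o h); apply: comp_surj.
have gv : generates (g ord0).
  by move=> v; have /eh[a <-] := C0 (h v); have [r ->] := gx a; exists r; rewrite linearZ /= ix.
have nI1 : ~ (1 : R) *: g ord0 = 0.
  rewrite scale1r => g0; apply: nV => v.
  by have [r ->] := gv v; rewrite g0 scaler0.
have [|f [_ sf]] := cyclic_map gv gw; last by exists f.
by move=> r r0; apply/aw; apply: (proper_ideal_sub noeth loc (annihilator_ideal (g ord0))).
Qed.

End Devissage.
End Cyclic.

(** * Regular sequences and vanishing of Ext *)

Section RegularSequences.
Variable R : comNzRingType.
Implicit Types A B C K L P Q V H X Y N W M : lmodType R.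
Implicit Types s t : seq R.

Lemma in_ideal_mul_nil V (u : V) : in_ideal_mul [::] u <-> u = 0.
Proof.
split=> [[v ->]|->]; first by rewrite big_ord0.
by exists (fun=> 0); rewrite big_ord0.
Qed.

Lemma in_ideal_mul_cons V x s (u : V) :
  in_ideal_mul (x :: s) u <-> exists w u', u = x *: w + u' /\ in_ideal_mul s u'.
Proof.
split=> [[v ->]|[w [_ [-> [v ->]]]]].
  rewrite big_ord_recl; exists (v ord0), (\sum_(i < size s) s`_i *: v (fintype.lift ord0 i)).
  by split=> //; exists (fun i => v (fintype.lift ord0 i)).
exists (fun i : 'I_(size s).+1 => if unlift ord0 i is Some j then v j else w).
rewrite big_ord_recl unlift_none; congr (_ + _).
by apply: eq_bigr => i _; rewrite liftK.
Qed.

Lemma in_ideal_mul_quot V V' x s (i : {linear V -> V}) (g : {linear V -> V'}) (u : V) :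
  ses i g -> (forall v, i v = x *: v) -> in_ideal_mul s (g u) <-> in_ideal_mul (x :: s) u.
Proof.
move=> [_ sg eg] iE; rewrite in_ideal_mul_cons; split=> [[v vE]|[w [u' [-> [v vE]]]]].
  have /choice[r rE] (k : 'I_(size s)) := sg (v k).
  pose u' := \sum_(k < size s) s`_k *: r k.
  have /eg[w wE] : g (u - u') = 0.
    rewrite linearB vE linear_sum; apply/eqP; rewrite subr_eq0; apply/eqP.
    by apply: eq_bigr => k _; rewrite linearZ /= rE.
  by exists w, u'; rewrite -iE wE subrK; split=> //; exists r.
exists (fun k => g (v k)); rewrite linearD -iE (exact0 eg) add0r vE linear_sum.
by apply: eq_bigr => k _; rewrite linearZ.
Qed.

Lemma regular_seq_cons V x s : regular_seq V (x :: s) ->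
  (forall v : V, x *: v = 0 -> v = 0) /\
  forall V' (i : {linear V -> V}) (g : {linear V -> V'}),
    ses i g -> (forall v, i v = x *: v) -> regular_seq V' s.
Proof.
move=> [reg [u0 nu0]]; split=> [v xv|V' i g se iE].
  have := reg 0%N erefl v; rewrite take0 /= !in_ideal_mul_nil; exact.
have [_ sg _] := se; split; last by exists (g u0); rewrite (in_ideal_mul_quot s u0 se iE).
move=> k ks u; have [v <-] := sg u.
rewrite -[s`_k *: g v]/(( *:%R) s`_k (g v)) -linearZ !(in_ideal_mul_quot _ _ se iE).
exact: (reg k.+1 ks v).
Qed.

Lemma regular_quotient V x s : regular_seq V (x :: s) ->
  exists V' (i : {linear V -> V}) (g : {linear V -> V'}),
  [/\ ses i g, forall v, i v = x *: v & regular_seq V' s].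
Proof.
move=> /regular_seq_cons[xr qr]; have [i iE] := scale_ex V x.
have ii : injective i by apply: linear_inj => v; rewrite iE; apply: xr.
have [V' [g se]] := coker_ses ii.
by exists V', i, g; split=> //; apply: qr se iE.
Qed.

(** Dividing N by the first element shortens the sequence and lowers the degree. In degree 0 that
    element is injective on N while a power of it kills the image of H. *)
Lemma ext_zero_killed s H N n : regular_seq N s ->
  (forall x, x \in s -> exists l, forall h : H, x ^+ l *: h = 0) ->
  (n < size s)%N -> ext_zero n H N.
Proof.
elim: s N n => [//|x s IH] N n reg xH ns.
have [l lH] := xH x (mem_head _ _).
have [xr _] := regular_seq_cons reg.
have [N' [i [g [se iE reg']]]] := regular_quotient reg.
case: n ns => [_|n ns].
  move=> u h; have : x ^+ l *: u h = 0 by rewrite -linearZ lH linear0.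
  by elim: l {lH} => [|l IHl]; rewrite ?scale1r // exprS -scalerA => /xr.
apply: (ext_zero_nilpotent se iE lH); apply: IH => // y ys.
by apply: xH; rewrite inE ys orbT.
Qed.

(** Each division by a regular element raises the bound by one. For [V = R^o] this plays the role of
    the Koszul resolution of R/(s). *)
Lemma ext_zero_regular_quotient s V N k : regular_seq V s ->
  (forall j, (k < j)%N -> ext_zero j V N) ->
  exists V' (g : {linear V -> V'}), [/\ surjective g,
    forall u, g u = 0 <-> in_ideal_mul s u &
    forall j, (k + size s < j)%N -> ext_zero j V' N].
Proof.
elim: s V k => [|x s IH] V k reg eV.
  exists V, idfun; split=> [y|u|j]; first by exists y.
    by rewrite in_ideal_mul_nil.
  by rewrite addn0; apply: eV.
have [V1 [i [g [se iE reg']]]] := regular_quotient reg.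
have [|V' [h [sh hk eV']]] := IH V1 k.+1 reg'.
  case=> [//|j] kj; apply: (ext_zero_sesr se); first exact: eV.
  by apply: eV; apply: leqW.
have [_ sg _] := se; exists V', (h \o g); split.
- exact: comp_surj.
- by move=> u /=; rewrite hk (in_ideal_mul_quot s u se iE).
by move=> j; rewrite addnS -addSn; apply: eV'.
Qed.

(** By [ext_zero_regular], going back from V/xV to V lowers the degree by one. If [s] has length
    [k], all positive degrees are covered. *)
Lemma ext_zero_depth m s V N k : noetherian R -> local_ring m ->
  {subset s <= m} -> regular_seq V s ->
  finitely_generated V -> finitely_generated N ->
  (forall X j, finitely_generated X -> (k < j)%N -> ext_zero j X N) ->
  forall j, (0 < j)%N -> (k < j + size s)%N -> ext_zero j V N.
Proof.
move=> noeth loc sm reg fV fN ek; elim: s V sm reg fV => [|x s IH] V sm reg fV [//|j] _.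
  by rewrite addn0; apply: ek.
have [V' [i [g [se iE reg']]]] := regular_quotient reg.
have [_ sg _] := se.
rewrite /= addnS -addSn => kj.
apply: (ext_zero_regular noeth loc se iE) => //; first exact/sm/mem_head.
apply: IH => // [y ys|]; first by apply: sm; rewrite inE ys orbT.
exact: fg_surj sg fV.
Qed.

End RegularSequences.

(** * Ext above the dimension *)

Section Dimension.
Variable R : comNzRingType.
Hypothesis noeth : noetherian R.
Implicit Types A B C K L P Q V H X Y N W M : lmodType R.
Implicit Types I J S : R -> Prop.
Implicit Types s : seq R.

Definition prime I : Prop := [/\ ideal I, ~ I 1 & forall a b, I (a * b) -> I a \/ I b].

(** An ideal maximal among those that contain I and avoid a multiplicative set is prime. *)
Lemma prime_avoiding I S : ideal I -> S 1 -> (forall a b, S a -> S b -> S (a * b)) ->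
  (forall x, I x -> ~ S x) ->
  exists J, [/\ prime J, forall x, I x -> J x & forall x, J x -> ~ S x].
Proof.
move=> iI S1 SM IS.
have [|J [iJ [IJ JS] mJ]] := ideal_maximal_ex noeth
  (F := fun J => (forall x, I x -> J x) /\ forall x, J x -> ~ S x); first by exists I.
have big a : ~ J a -> exists r y, J y /\ S (r * a + y).
  move=> na; apply: contrapT => nS; apply: na.
  apply: (mJ _ (ideal_add a iJ)) => [|x Jx|]; last first.
  - by exists 1, 0; rewrite mul1r addr0; split=> //; case: iJ.
  - by exists 0, x; rewrite mul0r add0r.
  split=> [x /IJ Jx|x [r [y [Jy ->]]] Sx]; first by exists 0, x; rewrite mul0r add0r.
  by apply: nS; exists r, y.
exists J; split=> //; split=> // [/JS|a b Jab]; first exact.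
apply: contrapT => /not_orP[/big[r [y [Jy Sa]]] /big[r' [y' [Jy' Sb]]]].
apply: (JS _ _ (SM _ _ Sa Sb)).
have -> : (r * a + y) * (r' * b + y') = (r * r') * (a * b) + ((r' * b + y') * y + (r * a) * y').
  by ring.
by do 2?[apply: idealD => //]; apply: idealM.
Qed.

Lemma ideal_in_ideal_mul s : ideal (fun x : R => in_ideal_mul s (x : R^o)).
Proof.
split=> [|a x y [v vE] [w wE]].
  by exists (fun=> 0); rewrite big1 // => i _; rewrite scaler0.
exists (fun i => (a : R) *: v i + w i).
under eq_bigr do rewrite scalerDr scalerA mulrC -scalerA.
by rewrite big_split /= -scaler_sumr -vE -wE.
Qed.

Lemma in_ideal_mul_rcons V x s (u : V) :
  in_ideal_mul (rcons s x) u <-> exists w u', u = x *: w + u' /\ in_ideal_mul s u'.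
Proof.
elim: s u => [|y s IH] u; first by rewrite -cats1; exact: in_ideal_mul_cons.
rewrite rcons_cons in_ideal_mul_cons; split=> [[w [u' [-> /IH[z [u'' [-> su]]]]]]|].
  exists z, (y *: w + u''); split; first by rewrite addrCA.
  by apply/in_ideal_mul_cons; exists w, u''.
move=> [w [u' [-> /in_ideal_mul_cons[z [u'' [-> su]]]]]].
exists z, (x *: w + u''); split; first by rewrite addrCA.
by apply/IH; exists w, u''.
Qed.

(* Below a prime containing [s_0, ..., s_k] there is a prime containing [s_0, ..., s_(k-1)] but
   not [s_k]: by regularity, no multiple of a power of [s_k] by an element outside the given
   prime lies in the ideal [(s_0, ..., s_(k-1))]. *)
Lemma prime_chain_above s k J : regular_seq R^o s -> (k <= size s)%N -> prime J ->
  (forall x : R, in_ideal_mul (take k s) (x : R^o) -> J x) ->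
  exists c : nat -> prime_idealr R, prime_chain k c /\ forall x, x \in c k <-> J x.
Proof.
move=> [reg _]; elim: k J => [|k IH] J ks [iJ nJ1 pJ] sJ.
  by have [p pE] := prime_of_ideal iJ nJ1 pJ; exists (fun=> p); split.
have rc : take k.+1 s = rcons (take k s) s`_k by rewrite (take_nth 0).
set x := s`_k in rc.
have sub (y : R) : in_ideal_mul (take k s) (y : R^o) -> in_ideal_mul (take k.+1 s) (y : R^o).
  by move=> ky; rewrite rc; apply/in_ideal_mul_rcons; exists 0, y; rewrite scaler0 add0r.
have Jx : J x.
  apply: sJ; rewrite rc; apply/in_ideal_mul_rcons; exists 1, 0; rewrite addr0.
  by split; [rewrite /GRing.scale /= mulr1 | case: (ideal_in_ideal_mul (take k s))].
(* [S] contains the complement of J ([n = 0]) and x itself ([t = 1]), so a prime that avoids it lies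
   inside J and does not contain x. *)
pose S y := exists t n, ~ J t /\ y = x ^+ n * t.
have [||| J' [pJ' subJ' J'S]] := @prime_avoiding _ S (ideal_in_ideal_mul (take k s)).
- by exists 1, 0%N; rewrite mulr1.
- move=> _ _ [t [n [nt ->]]] [t' [n' [nt' ->]]]; exists (t * t'), (n + n')%N; split.
    by move=> /pJ[].
  by rewrite exprD mulrACA.
- move=> y ky [t [n [nt yE]]]; apply/nt/sJ/sub; move: ky; rewrite yE => {y yE}.
  elim: n => [|n IHn]; first by rewrite mul1r.
  rewrite exprS -mulrA => h; apply: IHn; exact: (reg k ks (x ^+ n * t : R^o) h).
have [c [cc cJ']] := IH J' (ltnW ks) pJ' subJ'.
have [p pE] := prime_of_ideal iJ nJ1 pJ.
exists (fun i => if (i <= k)%N then c i else p); split; last by rewrite ltnn.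
move=> i; rewrite ltnS => ik; rewrite ik; have [ik'|ki] := ltnP i k; first exact: cc.
have -> : i = k by apply/eqP; rewrite eqn_leq ik ki.
split=> [y /cJ' J'y|]; last first.
  exists x; first exact/pE.
  apply/negP => /cJ'/J'S; apply; exists 1, 1%N; split=> //.
  by rewrite mulr1.
apply/pE; apply: contrapT => nJy; apply: (J'S y J'y); exists y, 0%N; split=> //.
by rewrite mul1r.
Qed.

Variable m : idealr R.
Hypothesis loc : local_ring m.

Lemma local_prime : prime (fun x => x \in m).
Proof.
split=> [||a b abm]; [exact: ideal_of_idealr | by rewrite idealr1|].
have [am|/(local_unit noeth loc)[u ua]] := boolP (a \in m); [by left|right].
by rewrite -[b]mul1r -ua -mulrA; apply: idealMr.
Qed.

Variable d : nat.
Hypothesis kd : krull_dim R d.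
Variable s : seq R.
Hypotheses (sd : size s = d) (reg : regular_seq R^o s).

(** J is the top of a chain of length d; if it missed an element of [m], adding [m] would give a
    chain of length d + 1. *)
Lemma prime_over_regular J : prime J ->
  (forall x : R, in_ideal_mul s (x : R^o) -> J x) -> forall x, x \in m -> J x.
Proof.
move=> pJ sJ x xm; apply: contrapT => nJx; have [iJ nJ1 _] := pJ.
rewrite -(take_size s) in sJ.
have [c [cc cJ]] := prime_chain_above reg (leqnn _) pJ sJ.
have [_ m1 mp] := local_prime.
have [p pE] := prime_of_ideal (ideal_of_idealr m) m1 mp.
suff: prime_chain d.+1 (fun i => if (i <= d)%N then c i else p).
  by move=> /kd.2; rewrite ltnn.
move=> i; rewrite ltnS => ik; rewrite ik; have [ik'|ki] := ltnP i d; first by apply: cc; rewrite sd.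
have -> : i = size s by apply/eqP; rewrite eqn_leq sd ik ki.
split=> [y /cJ Jy|]; first by apply/pE; apply: (proper_ideal_sub noeth loc iJ nJ1 Jy).
by exists x; [apply/pE | apply/negP => /cJ].
Qed.

(* A maximal annihilator of a nonzero element of R/(s) is a prime over (s), hence equals m. *)
Lemma residue_in_quotient : exists a : R, forall r : R, in_ideal_mul s (r * a : R^o) <-> r \in m.
Proof.
have iI := ideal_in_ideal_mul s; pose I (x : R) := in_ideal_mul s (x : R^o).
have nI1 : ~ I 1.
  have [_ [u nu]] := reg; apply: contra_not nu => I1.
  by rewrite -[u]mulr1; apply: (idealM (I := I) u iI I1).
have [|J [iJ [a [na Ja]] mJ]] := ideal_maximal_ex noeth
   (F := fun J => exists a, ~ I a /\ forall x, J x <-> I (x * a)).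
  by exists I; split=> //; exists 1; split=> // x; rewrite mulr1.
have pJ : prime J.
  split=> // [/Ja|b c Jbc]; first by rewrite mul1r.
  apply: contrapT => /not_orP[nb nc]; apply: nb.
  have nca : ~ I (c * a) by move=> /Ja.
  apply: (mJ (fun x => I (x * (c * a)))).
  - exact: ideal_colon.
  - by exists (c * a).
  - by move=> x /Ja xa; rewrite mulrCA; apply: idealM.
  by rewrite mulrA; apply/Ja.
exists a => r; rewrite -/(I (r * a)) -Ja; split; last first.
  by apply: prime_over_regular => // x Ix; apply/Ja; rewrite mulrC; apply: idealM.
by have [_ nJ1 _] := pJ; apply: (proper_ideal_sub noeth loc iJ nJ1).
Qed.

(** For each j a devissage in X, given the vanishing in degree j + 1. The residue field embeds into
    R/(s), whose Ext vanishes above d, and the cokernel is handled one degree higher. *)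
Lemma ext_zero_above_dim N : finitely_generated N -> finite_id N ->
  forall X j, finitely_generated X -> (d < j)%N -> ext_zero j X N.
Proof.
move=> fN /finite_id_ext_zero[n en].
(* Descending induction on j, as an induction on a bound [k] for the distance from j up to n + 1. *)
suff H k : forall X j, finitely_generated X -> (d < j)%N -> (n < j + k)%N -> ext_zero j X N.
  by move=> X j fX dj; apply: (H n.+1) => //; rewrite addnS ltnS leq_addl.
elim: k => [|k IH] X j fX dj; first by rewrite addn0 => /en.
rewrite addnS -addSn => njk; case: j dj njk => [//|j] dj njk.
have E Y : finitely_generated Y -> ext_zero j.+2 Y N by move=> fY; apply: IH => //; exact: ltnW.
have fR : finitely_generated R^o.
  by exists 1%N, (fun=> 1) => x; exists (fun=> x); rewrite big_ord1 /GRing.scale /= mulr1.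
have [|V' [h [sh hk eV']]] := @ext_zero_regular_quotient _ s R^o N 0 reg.
  case=> // l _; apply: ext_zero_projective => U V g f sg.
  have [u uE] := sg (f 1); have [t tE] := orbit_ex u.
  by exists t => x; rewrite /= tE linearZ /= uE -linearZ /= /GRing.scale /= mulr1.
move: X fX; apply: (devissage noeth loc) => [V zV|A B C i g se|V v [gv av]|V V1 y i g se iE ym fV _].
- exact: (@ext_zero_projective _ j _ N (is_zero_projective zV)).
- exact: (ext_zero_sesm se).
(* The class of [a] in R/(s) has annihilator exactly [m], so r v |-> r h(a) is a well-defined
   embedding. *)
- have [a aE] := residue_in_quotient.
  have [f fE] := orbit_ex v.
  have [q qE] := orbit_ex (h a).
  have [|r|w wE] := @surj_factor_ex _ _ _ _ f q.
  + by move=> y; have [r ->] := gv y; exists r; rewrite fE.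
  + rewrite fE qE => /av/aE ra.
    by rewrite -[_ *: h a]/(( *:%R) (r : R) (h a)) -linearZ; apply/hk.
  have iw : injective w.
    apply: linear_inj => x; have [r ->] := gv x; rewrite -fE wE qE fE => e.
    by apply/av/aE/hk; rewrite -e -linearZ.
  have [C [g se]] := coker_ses iw; have [_ sg _] := se.
  apply: (ext_zero_sesl se); first by apply: eV'; rewrite add0n sd.
  by apply: E; apply: fg_surj sg (fg_surj sh fR).
have [_ sg _] := se; apply: (ext_zero_regular noeth loc se iE) => //.
by apply: E; apply: fg_surj sg fV.
Qed.

(** The same descent in the coefficients: the residue field is a quotient of omega, and the kernel
    is handled one degree higher. *)
Lemma ext_zero_coef_above_dim X omega : finitely_generated X ->
  (exists n, forall N j, (n < j)%N -> ext_zero j X N) ->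
  finitely_generated omega -> ~ is_zero omega ->
  (forall j, (d < j)%N -> ext_zero j X omega) ->
  forall N j, finitely_generated N -> (d < j)%N -> ext_zero j X N.
Proof.
move=> fX [n en] fw nw ew.
suff H k : forall N j, finitely_generated N -> (d < j)%N -> (n < j + k)%N -> ext_zero j X N.
  by move=> N j fN dj; apply: (H n.+1) => //; rewrite addnS ltnS leq_addl.
elim: k => [|k IH] N j fN dj; first by rewrite addn0 => /en.
rewrite addnS -addSn => njk; case: j dj njk => [//|j] dj njk.
have E Y : finitely_generated Y -> ext_zero j.+2 X Y by move=> fY; apply: IH => //; exact: ltnW.
move: N fN; apply: (devissage noeth loc) => [V zV|A B C i g se|V v cv|V V1 y i g se iE ym fV].
- by move=> K L i g _ u; exists \0 => x; rewrite [RHS]zV.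
- exact: (ext_zero_coefm se).
- have [f sf] := surj_residue noeth loc fw nw cv.
  have [K [i se]] := ker_ses sf; have [ii _ _] := se.
  apply: (ext_zero_coefr se); first exact: ew.
  by apply: E; apply: fg_inj ii fw.
exact: (ext_zero_coef_regular noeth loc se iE).
Qed.

End Dimension.

(** * Maps factoring through free modules *)

Section FactorsThroughFree.
Variable R : comNzRingType.
Implicit Types A B C K L P Q V H X Y N W M : lmodType R.

Definition free_factor M (c : R) : Prop :=
  exists n (f : {linear M -> 'rV[R]_n}) (g : {linear 'rV[R]_n -> M}),
  forall x, c *: x = g (f x).

Lemma free_factor_ideal M : ideal (free_factor M).
Proof.
split=> [|a b c [n [f [g E]]] [n' [f' [g' E']]]].
  by exists 0%N, \0, \0 => x; rewrite scale0r.
have [h hE] := pairing_ex f f'.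
have [r rE] : exists r : {linear M -> 'rV[R]_(n + n')}, forall x, r x = row_mx (f x) (f' x).
  by apply: linear_ex => t x y; rewrite (linearP f) (linearP f') scale_row_mx add_row_mx.
have [k kE] := scale_ex M a.
exists (n + n')%N, r, ((k \o (g \o lsubmx)) \+ (g' \o rsubmx)) => x /=.
by rewrite kE rE row_mxKl row_mxKr -E -E' scalerDl scalerA.
Qed.

Variable p : prime_idealr R.

Lemma common_denominator V (l : seq (locmod p V)) :
  exists t : denom p, forall z, z \in l -> exists x, z = locfrac x t.
Proof.
elim: l => [|z l [t H]]; first by exists (denom1 p).
elim/locfrac_ind: z => x s; exists (denomM s t) => w; rewrite inE => /orP[/eqP->|/H[y ->]].
  by exists (sval t *: x); apply: locfrac_eq; rewrite /= scalerA.
by exists (sval s *: y); apply: locfrac_eq; rewrite /= scalerA mulrC.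
Qed.

Lemma common_annihilator (I : finType) V (y : I -> V) :
  (forall i, exists u : denom p, sval u *: y i = 0) ->
  exists u : denom p, forall i, sval u *: y i = 0.
Proof.
move=> H; suff [u uE] : exists u : denom p, forall i, i \in enum I -> sval u *: y i = 0.
  by exists u => i; apply: uE; rewrite mem_enum.
elim: (enum I) => [|i l [u uE]]; first by exists (denom1 p).
have [v vE] := H i; exists (denomM v u) => j /=; rewrite inE => /orP[/eqP->|/uE e].
  by rewrite mulrC -scalerA vE scaler0.
by rewrite -scalerA e scaler0.
Qed.

Lemma locfrac0 V (x : V) (t : denom p) :
  locfrac x t = 0 <-> exists u : denom p, sval u *: x = 0.
Proof.
rewrite -[0]/(locfrac 0 (denom1 p)) locfracP; split=> -[u uE]; exists u.
  by move: uE; rewrite scaler0 /= mulr1.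
by rewrite scaler0 /= mulr1.
Qed.

Lemma locfrac_addE V (x y : V) (t : denom p) : locfrac x t + locfrac y t = locfrac (x + y) t.
Proof.
rewrite [LHS]locfracD; apply: locfrac_eq.
by rewrite /= -scalerDr scalerA.
Qed.

Lemma locfrac_sumE V n (x : 'I_n -> V) (t : denom p) :
  \sum_i locfrac (x i) t = locfrac (\sum_i x i) t.
Proof.
elim: n x => [|n IH] x; last by rewrite !big_ord_recl IH locfrac_addE.
by rewrite !big_ord0; apply/esym/locfrac0; exists (denom1 p); rewrite scaler0.
Qed.

Lemma locfrac_scaleE V (r : R) (s : denom p) (x : V) t :
  (locfrac (r : R^o) s : locring p) *: locfrac x t = locfrac (r *: x) (denomM s t).
Proof. exact: locfracZ. Qed.

(** Denominators are cleared in an isomorphism of M_p with a free module: [c (j, k) / t] are the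
    coordinates of the generators of M, and [w k / s] are the images of the basis vectors. *)
Lemma free_factor_of_free M q b (phi : {linear 'rV[R]_q -> 'rV[R]_b}) (e : {linear 'rV[R]_b -> M}) :
  surjective e -> exact_at phi e -> is_free (locmod p M) ->
  exists2 c, c \notin p & free_factor M c.
Proof.
move=> se ee [n [F [G FK GK]]].
have GL : linear G.
  by move=> a x y; rewrite -{1}[x]GK -{1}[y]GK -linearP FK.
pose E j : locmod p M := locfrac (e (delta_mx 0 j)) (denom1 p).
have [t tE] := common_denominator [seq G (E jk.1) 0 jk.2 | jk : 'I_b * 'I_n].
have /choice[c cE] (jk : 'I_b * 'I_n) : exists x : R^o, G (E jk.1) 0 jk.2 = locfrac x t.
  by apply: tE; apply: map_f; rewrite mem_enum.
have [s sE] := common_denominator [seq F (delta_mx 0 k) | k : 'I_n].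
have /choice[w wE] (k : 'I_n) : exists x, F (delta_mx 0 k) = locfrac x s.
  by apply: sE; apply: map_f; rewrite mem_enum.
have EE j : E j = locfrac (\sum_k (c (j, k) : R) *: w k) (denomM t s).
  rewrite -[LHS]GK [G _]row_sum_delta linear_sum -locfrac_sumE.
  by apply: eq_bigr => k _; rewrite linearZ /= wE (cE (j, k)) locfrac_scaleE.
(* The numerators respect the relations of M only locally; after multiplication by [u] they define a
   map on M. *)
have [u uE] : exists u : denom p, forall lk : 'I_q * 'I_n,
    sval u *: (\sum_j phi (delta_mx 0 lk.1) 0 j * c (j, lk.2) : R^o) = 0.
  apply: common_annihilator => -[l k] /=; apply/(locfrac0 _ t); rewrite -locfrac_sumE.
  have : \sum_j (locfrac (phi (delta_mx 0 l) 0 j : R^o) (denom1 p) : locring p) *: E j = 0.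
    under eq_bigr do rewrite locfrac_scaleE -linearZ.
    rewrite locfrac_sumE -linear_sum -row_sum_delta (exact0 ee).
    by apply/locfrac0; exists (denom1 p); rewrite scaler0.
  move=> /(congr1 (mklin GL)); rewrite linear0 linear_sum => /(congr1 (fun x : 'rV_n => x 0 k)).
  rewrite summxE mxE => e0; apply: etrans e0; apply: eq_bigr => j _.
  rewrite linearZ /= mxE (cE (j, k)).
  by rewrite [RHS]locfrac_scaleE; apply: locfrac_eq => /=; rewrite mul1r.
have [h hE] : exists h : {linear 'rV[R]_b -> 'rV[R]_n},
    forall x, h x = \row_k (sval u * \sum_j x 0 j * c (j, k)).
  apply: linear_ex => a x y; apply/rowP => k; rewrite !mxE mulrCA -mulrDr.
  congr (_ * _); rewrite mulr_sumr -big_split /=; apply: eq_bigr => j _.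
  by rewrite !mxE mulrDl mulrA.
have [|f fE] := @surj_factor_ex _ _ _ _ e h se.
  move=> _ /ee[x <-]; rewrite [x]row_sum_delta !linear_sum big1 // => l _.
  rewrite !linearZ /= hE; suff -> : \row_k (sval u * \sum_j phi (delta_mx 0 l) 0 j * c (j, k)) = 0.
    by rewrite scaler0.
  by apply/rowP => k; rewrite !mxE; exact: (uE (l, k)).
(* Likewise the expansion of the generators in the [w k] holds in M only up to a factor [v], which
   goes into [g]. *)
have [v vE] : exists v : denom p, forall j,
    sval v *: ((sval t * sval s) *: e (delta_mx 0 j) - \sum_k (c (j, k) : R) *: w k) = 0.
  apply: common_annihilator => j; have /locfracP[v vE] := EE j.
  exists v; rewrite scalerBr scalerA vE /= mulr1 subrr //.
have [g gE] : exists g : {linear 'rV[R]_n -> M}, forall x, g x = \sum_k x 0 k *: (sval v *: w k).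
  apply: linear_ex => a x y; rewrite scaler_sumr -big_split /=.
  by apply: eq_bigr => k _; rewrite !mxE scalerDl -scalerA.
exists (sval (denomM (denomM u v) (denomM t s))); first exact: (proj2_sig (denomM _ _)).
exists n, f, g => x; have [y <-] := se x; rewrite fE.
rewrite [y]row_sum_delta !linear_sum; apply: eq_bigr => j _.
rewrite !linearZ /=; congr (_ *: _).
have := vE j; rewrite scalerBr => /eqP; rewrite subr_eq0 scalerA => /eqP vj.
rewrite -mulrA -scalerA vj gE !scaler_sumr; apply: eq_bigr => k _.
rewrite hE !mxE (bigD1 j) //= big1 => [|i ij]; last first.
  by rewrite mxE eqxx (negPf ij) mul0r.
by rewrite mxE !eqxx mul1r addr0 !scalerA; congr (_ *: _); rewrite -!mulrA; congr (_ * _); rewrite mulrC.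
Qed.

End FactorsThroughFree.

(** * Vector bundles on the punctured spectrum *)

Section VectorBundle.
Variable R : comNzRingType.
Hypothesis noeth : noetherian R.
Variable m : idealr R.
Hypothesis loc : local_ring m.

(** If the ideal of [free_factor] scalars contained no power of x, some prime over it would not
    contain x. That prime differs from [m], so M is free there, which contradicts
    [free_factor_of_free]. *)
Lemma vector_bundle_free_factor (M : lmodType R) q b
  (phi : {linear 'rV[R]_q -> 'rV[R]_b}) (e : {linear 'rV[R]_b -> M}) :
  surjective e -> exact_at phi e -> vector_bundle m M ->
  forall x, x \in m -> exists l, free_factor M (x ^+ l).
Proof.
move=> se ee [_ fr] x xm; apply: contrapT => nx.
have [||| J [[iJ nJ1 pJ] aJ JS]] :=
  @prime_avoiding R noeth _ (fun y => exists l, y = x ^+ l) (free_factor_ideal M).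
- by exists 0%N.
- by move=> _ _ [k ->] [l ->]; exists (k + l)%N; rewrite exprD.
- by move=> y fy [l yl]; apply: nx; exists l; rewrite -yl.
have [p pE] := prime_of_ideal iJ nJ1 pJ.
have [|c cp fc] := @free_factor_of_free R p M q b phi e se ee.
  apply: fr => pm; apply: (JS x); last by exists 1%N.
  by apply/pE; rewrite pm.
by case/negP: cp; apply/pE/aJ.
Qed.

End VectorBundle.

(** * Tensoring a matrix with a module *)

Section MatrixAction.
Variable R : comNzRingType.
Variable M : lmodType R.
Implicit Types H I K Y : lmodType R.

Lemma pow_delta b (z : 'I_b -> M) : z = \sum_i (fun k => (k == i)%:R *: z i) :> pow b M.
Proof.
apply/funext => k; rewrite fct_sumE (bigD1 k) //= eqxx scale1r big1 ?addr0 // => i ik.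
by rewrite eq_sym (negPf ik) scale0r.
Qed.

(* The map [M^b -> M^a] obtained from [R^b -> R^a], [x |-> x *m B] by tensoring with M. *)
Definition mx_action a b (B : 'M[R]_(b, a)) (z : pow b M) : pow a M :=
  fun j => \sum_i B i j *: (z : 'I_b -> M) i.

Lemma mx_action_linear a b (B : 'M[R]_(b, a)) : linear (mx_action B).
Proof.
move=> c x y; apply/funext => j.
rewrite -[RHS]/(c *: mx_action B x j + mx_action B y j) /mx_action scaler_sumr -big_split /=.
apply: eq_bigr => i _; rewrite -[(c *: x + y) i]/(c *: (x : 'I_b -> M) i + (y : 'I_b -> M) i).
by rewrite scalerDr !scalerA mulrC.
Qed.

HB.instance Definition _ a b (B : 'M[R]_(b, a)) :=
  GRing.isLinear.Build R (pow b M) (pow a M) *:%R (mx_action B) (mx_action_linear B).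

Lemma mx_action_mul a b c (B : 'M[R]_(b, a)) (C : 'M[R]_(c, b)) z :
  mx_action B (mx_action C z) = mx_action (C *m B) z.
Proof.
apply/funext => j; rewrite /mx_action.
under eq_bigr do rewrite scaler_sumr.
rewrite exchange_big; apply: eq_bigr => k _ /=; rewrite mxE scaler_suml.
by apply: eq_bigr => i _; rewrite scalerA mulrC.
Qed.

Lemma mx_action_row a b (B : 'M[R]_(b, a)) (x : 'rV[R]_b) (v : M) :
  mx_action B (fun i => x 0 i *: v) = (fun j => (x *m B) 0 j *: v).
Proof.
apply/funext => j; rewrite /mx_action mxE scaler_suml.
by apply: eq_bigr => i _; rewrite scalerA mulrC.
Qed.

Definition mx_exact a b c (C : 'M[R]_(c, b)) (B : 'M[R]_(b, a)) : Prop :=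
  exact_at (mulmxr C : 'rV_c -> 'rV_b) (mulmxr B).

Lemma mx_exact0 a b c (C : 'M[R]_(c, b)) (B : 'M[R]_(b, a)) : mx_exact C B -> C *m B = 0.
Proof.
move=> e; apply/row_matrixP => i; rewrite !rowE mulmxA mulmx0.
by apply/(e (delta_mx 0 i *m C)); exists (delta_mx 0 i).
Qed.

Lemma mx_syzygy a b (B : 'M[R]_(b, a)) : noetherian R ->
  exists c (C : 'M[R]_(c, b)), mx_exact C B.
Proof.
move=> noeth; have [Y [h [k [sh ik kh]]]] := im_ses (mulmxr B : {linear 'rV[R]_b -> 'rV_a}).
have [K [i s]] := ker_ses sh; have [ii _ eh] := s.
have /fgP[c [g sg]] := fg_inj noeth ii (fg_row R b).
exists c, (lin1_mx (i \o g)) => y /=; split=> [yB|[x <-]].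
  have /eh[z zE] : h y = 0 by apply: ik; rewrite kh linear0.
  by have [x xz] := sg z; exists x; rewrite mul_rV_lin1 /= xz.
by rewrite mul_rV_lin1 -[_ *m B]/(mulmxr B _) -kh /= (exact0 eh) linear0.
Qed.

(* The homology H at [M^b] of [M^c -> M^b -> M^a], which is a Tor module. *)
Lemma mx_homology a b c (C : 'M[R]_(c, b)) (B : 'M[R]_(b, a)) Y (h : {linear pow b M -> Y}) :
  mx_exact C B -> surjective h -> exact_at (mx_action C) h ->
  exists H I (i : {linear H -> Y}) (q : {linear Y -> I}) (j : {linear I -> pow a M}),
  [/\ ses i q, injective j, forall z, j (q (h z)) = mx_action B z &
      forall s, free_factor M s -> forall x : H, s *: x = 0].
Proof.
move=> eCB sh eh; have [I [h1 [j [sh1 ij jh]]]] := im_ses (mx_action B).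
have [|q qE] := @surj_factor_ex _ _ _ _ h h1 sh.
  move=> x /eh[w <-]; apply: ij.
  by rewrite jh /= mx_action_mul (mx_exact0 eCB) linear0; apply/funext => k;
     rewrite /mx_action big1 // => l _; rewrite mxE scale0r.
have sq : surjective q by move=> y; have [z <-] := sh1 y; exists (h z); rewrite qE.
have [H [i se]] := ker_ses sq; have [ii _ eq] := se.
exists H, I, i, q, j; split=> // [z|s [n [f [g sE]]] x]; first by rewrite qE jh.
apply: ii; rewrite linear0 linearZ /=; have [z zE] := sh (i x); rewrite -zE.
have Bz : mx_action B z = 0 by rewrite -jh -qE zE (exact0 eq) linear0.
rewrite -linearZ /=; apply/eh.
(* Each coordinate of [f] turns the cycle [z] into a cycle over R, which is a boundary by exactness;
   mapping back by [g] makes [s *: z] a boundary. *)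
have /choice[w wE] (l : 'I_n) : exists w : 'rV[R]_c, w *m C = \row_i f ((z : 'I_b -> M) i) 0 l.
  apply/eCB => /=; apply/rowP => k; rewrite !mxE.
  have := congr1 (fun y : 'I_a -> M => f (y k) 0 l) Bz.
  rewrite /mx_action linear_sum summxE [f ((0 : pow a M) k)]linear0 mxE => e0; rewrite -[RHS]e0.
  by apply: eq_bigr => i0 _; rewrite linearZ !mxE mulrC.
exists (fun k => \sum_l w l 0 k *: g (delta_mx 0 l)); apply/funext => k.
rewrite -[RHS]/(s *: (z : 'I_b -> M) k) sE [f _]row_sum_delta linear_sum /mx_action.
under eq_bigr do rewrite scaler_sumr.
rewrite exchange_big; apply: eq_bigr => l _ /=; rewrite linearZ /=.
have := congr1 (fun y : 'rV_b => y 0 k) (wE l); rewrite !mxE => <-.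
rewrite scaler_suml; by apply: eq_bigr => i0 _; rewrite scalerA mulrC.
Qed.

End MatrixAction.

(** * Ext and tensor products *)

Section TensorExt.
Variable R : comNzRingType.
Variables (M omega : lmodType R).
Implicit Types H I K T W X Y Z : lmodType R.

Lemma presentation_kernel a b (B : 'M[R]_(b, a)) X (g : {linear 'rV[R]_a -> X}) :
  surjective g -> exact_at (mulmxr B : 'rV_b -> 'rV_a) g ->
  exists K (i : {linear K -> 'rV[R]_a}) (p : {linear 'rV[R]_b -> K}),
    [/\ ses i g, surjective p & forall x, i (p x) = x *m B].
Proof.
move=> sg eg; have [K [i sK]] := ker_ses sg; have [ii _ ei] := sK.
have [|p pE] := @inj_lift_ex _ _ _ _ i (mulmxr B : {linear 'rV[R]_b -> 'rV_a}) ii.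
  by move=> x; apply/ei/eg; exists x.
exists K, i, p; split=> // y.
by have /eg[x xE] := exact0 ei y; exists x; apply: ii; rewrite pE; exact: xE.
Qed.

Lemma presentation_syzygy a b c (B : 'M[R]_(b, a)) (C : 'M[R]_(c, b)) K
    (i : {linear K -> 'rV[R]_a}) (p : {linear 'rV[R]_b -> K}) :
  injective i -> (forall x, i (p x) = x *m B) -> mx_exact C B ->
  exact_at (mulmxr C : 'rV_c -> 'rV_b) p.
Proof.
move=> ii pE eCB y; rewrite -(eCB y) /= -pE; split=> [->|e]; first exact: linear0.
by apply: ii; rewrite e linear0.
Qed.

(** Hom-tensor adjunction, with Y the tensor product of X and M: a map to omega on the image of M^b
    in M^a becomes a map from the syzygy of X to Hom(M, omega), and an extension of the latter to
    R^a becomes one of the former to M^a. *)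
Lemma tensor_ext1 a b (B : 'M[R]_(b, a)) X (g : {linear 'rV[R]_a -> X})
    Y (h : {linear pow a M -> Y}) :
  ext1_zero M omega ->
  surjective g -> exact_at (mulmxr B : 'rV_b -> 'rV_a) g ->
  surjective h -> exact_at (mx_action B : pow b M -> pow a M) h ->
  ext1_zero X (Hom_mod M omega) -> ext1_zero Y omega.
Proof.
move=> eM sg eg sh eh eX.
have [I [h1 [j [sh1 ij jh]]]] := im_ses (mx_action B : {linear pow b M -> pow a M}).
have sI : ses j h.
  split=> // y; rewrite (eh y); split=> -[x <-].
    by exists (h1 x); rewrite jh.
  by have [z <-] := sh1 x; exists z; rewrite jh.
apply: (ext1_zero_quot sI); first exact: (@ext_zero_pow R a 0 M omega eM).
move=> u.
have /choice[t tE] (x : 'rV[R]_b) : exists t : Hom_mod M omega,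
    forall v, val t v = u (h1 (fun i => x 0 i *: v)).
  have [f fE] : exists f : {linear M -> pow b M}, forall v, f v = fun i => x 0 i *: v.
    apply: linear_ex => c y z; apply/funext => i.
    by rewrite -[RHS]/(c *: (x 0 i *: y) + x 0 i *: z) scalerDr !scalerA mulrC.
  have [t tE] := hom_ex (u \o h1 \o f); exists t => v.
  by rewrite tE /= fE.
have [t' t'E] : exists t' : {linear 'rV[R]_b -> Hom_mod M omega}, forall x, t' x = t x.
  apply: linear_ex => c x y; apply/val_inj/funext => v.
  rewrite -[RHS]/(c *: val (t x) v + val (t y) v) !tE -!linearZ -!linearD /=.
  congr (u (h1 _)); apply/funext => i.
  rewrite -[RHS]/(c *: (x 0 i *: v) + y 0 i *: v).
  by rewrite !mxE scalerDl scalerA.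
have [K [i [p [sK sp pE]]]] := presentation_kernel sg eg; have [ii _ ei] := sK.
have [|w wE] := @surj_factor_ex _ _ _ _ p t' sp.
  move=> x px; rewrite t'E; apply/val_inj/funext => v; rewrite tE /=.
  suff -> : h1 (fun k => x 0 k *: v) = 0 by rewrite linear0.
  apply: ij; rewrite jh linear0 /= mx_action_row; apply/funext => k.
  by have := pE x; rewrite px linear0 /= => <-; rewrite mxE scale0r.
have [v vE] := eX _ _ _ _ sK w.
have [f fE] : exists f : {linear pow a M -> omega},
    forall z, f z = \sum_k val (v (delta_mx 0 k)) ((z : 'I_a -> M) k).
  apply: linear_ex => c x y; rewrite scaler_sumr -big_split /=; apply: eq_bigr => k _.
  exact: (hom_linear (v (delta_mx 0 k))).
exists f => y; have [z <-] := sh1 y; rewrite jh fE /= /mx_action.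
have vl k : val (v (delta_mx 0 k)) (\sum_i0 B i0 k *: (z : 'I_b -> M) i0) =
    \sum_i0 B i0 k *: val (v (delta_mx 0 k)) ((z : 'I_b -> M) i0).
  rewrite -[LHS]/(mklin (hom_linear (v (delta_mx 0 k))) _) linear_sum.
  by apply: eq_bigr => l _; rewrite linearZ.
under eq_bigr do rewrite vl.
rewrite exchange_big [X in h1 X](pow_delta (M := M) z) !linear_sum; apply: eq_bigr => l _ /=.
transitivity (val (v (delta_mx 0 l *m B)) ((z : 'I_b -> M) l)).
  rewrite [_ *m B]row_sum_delta linear_sum.
  have ev (F : 'I_a -> Hom_mod M omega) y0 : val (\sum_k F k) y0 = \sum_k val (F k) y0.
    by elim/big_rec2: _ => // k y1 y2 _ <-.
  rewrite ev; apply: eq_bigr => k _; rewrite linearZ /= -rowE mxE //.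
rewrite -pE vE wE t'E tE; congr (u (h1 _)).
by apply/funext => k; rewrite mxE eqxx eq_sym.
Qed.

Hypothesis noeth : noetherian R.
Variables (d : nat) (s : seq R).
Hypothesis eM : forall j, ext_zero j.+1 M omega.
Hypotheses (sd : size s = d) (reg : regular_seq omega s).
Hypothesis sM : forall x, x \in s -> exists l, free_factor M (x ^+ l).

Lemma ext_zero_homology Z n : (forall c, free_factor M c -> forall x : Z, c *: x = 0) ->
  (n < d)%N -> ext_zero n Z omega.
Proof.
move=> Z0 nd; apply: (ext_zero_killed reg); last by rewrite sd.
by move=> x /sM[l fl]; exists l; exact: Z0.
Qed.

(* [Y] is the tensor product of X and M. *)
Lemma tensor_ext j : (j < d)%N -> forall a b (B : 'M[R]_(b, a)) X (g : {linear 'rV[R]_a -> X})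
    Y (h : {linear pow a M -> Y}),
  surjective g -> exact_at (mulmxr B : 'rV_b -> 'rV_a) g ->
  surjective h -> exact_at (mx_action B : pow b M -> pow a M) h ->
  ext_zero j.+1 X (Hom_mod M omega) -> ext_zero j.+1 Y omega.
Proof.
elim: j => [|j IH] jd a b B X g Y h sg eg sh eh; first exact: (tensor_ext1 (@eM 0%N) sg eg sh eh).
have [c [C eCB]] := mx_syzygy B noeth.
have [K [i [p [sK sp pE]]]] := presentation_kernel sg eg; have [ii _ ei] := sK.
have ep := presentation_syzygy ii pE eCB.
move=> /(ext_zero_syz j _ sK (@row_projective R a)) eK.
have [Z [hZ [shZ ehZ]]] := coker_ex (mx_action C : {linear pow c M -> pow b M}).
have eZ := IH (ltnW jd) _ _ C K p Z hZ sp ep shZ ehZ eK.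
(* [Z] is the tensor product of K and M, and [T] is Tor_1(X, M). The sequences 0 -> T -> Z -> I -> 0
   and 0 -> I -> M^a -> Y -> 0 carry the vanishing from Z to Y. *)
have [T [I [iT [q [k [sT ik kq T0]]]]]] := mx_homology eCB shZ ehZ.
have eI : ext_zero j.+1 I omega.
  by apply: (ext_zero_sesr sT) eZ; apply: ext_zero_homology T0 _; apply: ltnW.
have sI : ses k h.
  have [_ sq _] := sT; split=> // y; rewrite (eh y); split=> -[x <-].
    by exists (q (hZ x)); rewrite kq.
  by have [z <-] := sq x; have [t <-] := shZ z; exists t; rewrite kq.
by apply: (ext_zero_sesr sI eI); apply: ext_zero_pow.
Qed.

Hypothesis ed : forall X j, finitely_generated X -> (d < j)%N -> ext_zero j X omega.
Hypotheses (fM : finitely_generated M) (d0 : (0 < d)%N).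

(** [H] is Tor_1(X, M), inside the tensor product Z of M with the syzygy of X. The top case of
    [tensor_ext] gives Ext^d(Z, omega) = 0, and Ext^(d+1)(Z/H, omega) = 0 by [ed], so Ext^d(H,
    omega) = 0. *)
Lemma ext_zero_top_homology a b (B : 'M[R]_(b, a)) X (g : {linear 'rV[R]_a -> X}) :
  surjective g -> exact_at (mulmxr B : 'rV_b -> 'rV_a) g ->
  ext_zero d.+1 X (Hom_mod M omega) ->
  forall c (C : 'M[R]_(c, b)), mx_exact C B ->
  exists H Y (h : {linear pow b M -> Y}) (i : {linear H -> Y}),
    [/\ injective i, exact_at (mx_action C : pow c M -> pow b M) h,
        forall z, mx_action B z = 0 -> exists x, i x = h z,
        finitely_generated H &
        (forall c, free_factor M c -> forall x : H, c *: x = 0) /\ ext_zero d H omega].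
Proof.
move=> sg eg eX c C eCB.
have [K [i [p [sK sp pE]]]] := presentation_kernel sg eg; have [ii _ ei] := sK.
have ep := presentation_syzygy ii pE eCB.
have [Z [hZ [shZ ehZ]]] := coker_ex (mx_action C : {linear pow c M -> pow b M}).
have [H [I [iH [q [k [sH ik kq H0]]]]]] := mx_homology eCB shZ ehZ.
have [iiH sq eq] := sH.
have fZ : finitely_generated Z by apply: fg_surj shZ (fg_pow b fM).
exists H, Z, hZ, iH; split=> // [z Bz||].
- by apply/eq/ik; rewrite kq Bz linear0.
- exact: (fg_inj noeth iiH).
split=> //; case: d d0 eX ed (tensor_ext (j := d.-1)) => // d' _ eX ed' te.
apply: (ext_zero_sesl sH); last by apply: ed' => //; exact: fg_surj sq fZ.
apply: (te _ _ _ C K p Z hZ sp ep shZ ehZ); first by rewrite ltnS.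
exact/(ext_zero_syz d' _ sK (@row_projective R a)).
Qed.

End TensorExt.

(** * The transpose *)

Section Transpose.
Variable R : comNzRingType.

Lemma row_dual n : exists (f : {linear 'rV[R]_n -> Hom_mod 'rV[R]_n R^o})
    (f' : {linear Hom_mod 'rV[R]_n R^o -> 'rV[R]_n}),
  [/\ cancel f f', cancel f' f, forall x y, val (f x) y = \sum_i x 0 i * y 0 i
    & forall h i, f' h 0 i = val h (delta_mx 0 i)].
Proof.
have /choice[t tE] (x : 'rV[R]_n) : exists t : Hom_mod 'rV[R]_n R^o,
    forall y, val t y = \sum_i x 0 i * y 0 i.
  have [u uE] : exists u : {linear 'rV[R]_n -> R^o}, forall y, u y = \sum_i x 0 i * y 0 i.
    apply: linear_ex => a y z; rewrite scaler_sumr -big_split /=; apply: eq_bigr => i _.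
    by rewrite !mxE mulrDr mulrCA.
  by have [t tE] := hom_ex u; exists t => y; rewrite tE uE.
have [f fE] : exists f : {linear 'rV[R]_n -> Hom_mod 'rV[R]_n R^o}, forall x, f x = t x.
  apply: linear_ex => a x y; apply: hom_eq => z.
  rewrite hom_valP !tE scaler_sumr -big_split.
  by apply: eq_bigr => i _; rewrite !mxE mulrDl -mulrA.
have [f' f'E] : exists f' : {linear Hom_mod 'rV[R]_n R^o -> 'rV[R]_n},
    forall h, f' h = \row_i val h (delta_mx 0 i).
  by apply: linear_ex => a h h'; apply/rowP => i; rewrite !mxE hom_valP.
exists f, f'; split=> [x|h|x y|h i].
- apply/rowP => i; rewrite f'E mxE fE tE (bigD1 i) //= big1 => [|j ji].
    by rewrite mxE !eqxx mulr1 addr0.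
  by rewrite mxE (negPf ji) andbF mulr0.
- apply: hom_eq => y; rewrite fE tE f'E.
  rewrite [in RHS](row_sum_delta y) -[RHS]/(mklin (hom_linear h) _) linear_sum.
  by apply: eq_bigr => i _; rewrite linearZ mxE mulrC.
- by rewrite fE tE.
by rewrite f'E mxE.
Qed.

Lemma retract_projective (P Q : lmodType R) (f : {linear Q -> P}) (g : {linear P -> Q}) :
  cancel f g -> projective_module P -> projective_module Q.
Proof.
move=> fg pP U V q u sq; have [h hE] := pP _ _ q (u \o g) sq.
by exists (h \o f) => x /=; move: (hE (f x)) => /= ->; rewrite fg.
Qed.

Lemma row_dual_projective n : projective_module (Hom_mod 'rV[R]_n R^o).
Proof.
have [f [f' [_ f'K _ _]]] := row_dual n.
exact: (retract_projective f'K (@row_projective R n)).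
Qed.

Variables (q b : nat) (phi : {linear 'rV[R]_q -> 'rV[R]_b}).

(** In dual bases, precomposition with [phi] is the transposed matrix. *)
Lemma transpose_presentation : exists g : {linear 'rV[R]_q -> transpose phi},
  surjective g /\ exact_at (mulmxr (lin1_mx phi)^T : 'rV_b -> 'rV_q) g.
Proof.
have [g [sg gk]] := quot_ex (immod (@precomp R _ _ phi R^o)).
have [f [f' [fK f'K fE f'E]]] := row_dual q.
have [h [h' [hK h'K hE h'E]]] := row_dual b.
exists (g \o f); split=> [y|y /=].
  by have [t <-] := sg y; exists (f' t); rewrite /= f'K.
have pE x : precomp phi (h x) = f (x *m (lin1_mx phi)^T).
  apply/val_inj/funext => z; rewrite fE -[LHS]/(val (h x) (phi z)) hE.
  rewrite -[phi z]mul_rV_lin1.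
  under eq_bigr do rewrite mxE mulr_sumr.
  rewrite exchange_big; apply: eq_bigr => i _ /=; rewrite mxE mulr_suml.
  by apply: eq_bigr => j _; rewrite !mxE -mulrA [X in _ = _ * X]mulrC.
rewrite gk unfold_in; split=> [/asboolP[t tE]|[x <-]].
  by exists (h' t); apply: (can_inj fK); rewrite -pE h'K.
by apply/asboolP; exists (h x); exact: pE.
Qed.

Lemma transpose_fg : finitely_generated (transpose phi).
Proof.
by have [g [sg _]] := transpose_presentation; apply: fg_surj sg (fg_row R q).
Qed.

(** Dualizing the presentation gives an exact sequence 0 -> M^* -> F^* -> G^* -> Tr M -> 0, so M^*
    is a second syzygy of Tr M. *)
Lemma transpose_ext_zero (M N : lmodType R) (e : {linear 'rV[R]_b -> M}) j :
  surjective e -> exact_at phi e ->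
  ext_zero j.+1 (dual_mod M) N -> ext_zero j.+3 (transpose phi) N.
Proof.
move=> se ee eN.
have [I [h [k [sh ik kh]]]] := im_ses (@precomp R _ _ phi R^o).
have [g [sg gk]] := quot_ex (immod (@precomp R _ _ phi R^o)).
have s1 : ses k g.
  split=> // y; rewrite gk unfold_in; split=> [/asboolP[x <-]|[x <-]].
    by exists (h x); rewrite kh.
  by apply/asboolP; have [z <-] := sh x; exists z; rewrite kh.
have s2 : ses (@precomp R _ _ e R^o) h.
  split=> // [t t' tt'|t].
    apply/val_inj/funext => x; have [y <-] := se x.
    exact: (congr1 (fun u : Hom_mod _ _ => val u y) tt').
  split=> [ht|[x <-]].
    have [|v vE] := @surj_factor_ex _ _ _ _ e (mklin (hom_linear t)) se.
      move=> _ /ee[x <-].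
      have : @precomp R _ _ phi R^o t = 0 by rewrite -kh ht linear0.
      exact: (congr1 (fun u : Hom_mod _ _ => val u x)).
    have [v' v'E] := hom_ex v; exists v'; apply/val_inj/funext => x.
    by rewrite /= v'E vE.
  apply: ik; rewrite linear0 kh; apply/val_inj/funext => y /=.
  by rewrite (exact0 ee) -[LHS]/(mklin (hom_linear x) 0) linear0.
apply/(ext_zero_syz _ N s1 (@row_dual_projective q)).
exact/(ext_zero_syz _ N s2 (@row_dual_projective b)).
Qed.

End Transpose.

(** * Freeness from a factored identity, and the residue field *)

Section Freeness.
Variable R : comNzRingType.
Hypothesis noeth : noetherian R.
Variable m : idealr R.
Hypothesis loc : local_ring m.

(** M is projective, so [e] splits; minimality and Nakayama's lemma then make its kernel zero. *)
Lemma free_of_free_factor (M : lmodType R) q b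
    (phi : {linear 'rV[R]_q -> 'rV[R]_b}) (e : {linear 'rV[R]_b -> M}) :
  minimal_presentation m phi e -> free_factor M 1 -> is_free M.
Proof.
move=> [se _ em _] [n [f [g fg]]].
have [h hE] := @row_projective R n _ _ e g se; have {}hE x : e (h x) = g x by exact: hE.
have [K [i s]] := ker_ses se; have [ii _ ei] := s.
have [w wE] := comb_ex (-1) (h \o f \o e) idfun.
have [|r rE] := @inj_lift_ex _ _ _ _ i w ii.
  move=> x; apply/ei; rewrite wE linearD linearZ /= hE -fg.
  by rewrite scale1r scaleN1r addNr.
have ri x : r (i x) = x.
  by apply: ii; rewrite rE wE /= (exact0 ei) !linear0 add0r.
have [l [a aE]] := fg_inj noeth ii (fg_row R b).
have /choice[c cE] (j : 'I_b) := aE (r (delta_mx 0 j)).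
(* K is a direct summand of [R^b] contained in [m R^b], so [K = m K]. *)
have K0 : forall k, a k = 0.
  apply: (nakayama_gen noeth loc (S := fun v : K => v = 0)) => [|k].
    by split=> // t x y -> ->; rewrite scaler0 addr0.
  exists (fun u => \sum_j i (a k) 0 j * c j u); split=> [u|].
    apply: rpred_sum => j _; rewrite mulrC; apply: idealMr.
    by apply: em; exact: (exact0 ei).
  apply/eqP; rewrite subr_eq0; apply/eqP.
  rewrite -{1}[a k]ri [in LHS](row_sum_delta (i (a k))) linear_sum /=.
  under eq_bigr do rewrite linearZ /= cE scaler_sumr.
  rewrite exchange_big; apply: eq_bigr => u _ /=; rewrite scaler_suml.
  by apply: eq_bigr => j _; rewrite scalerA.
have ie : injective e.
  apply: linear_inj => x /ei[y <-]; have [t ->] := aE y.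
  by rewrite big1 ?linear0 // => k _; rewrite K0 scaler0.
have [|e' e'E] := @surj_factor_ex _ _ _ _ e idfun se.
  by move=> x ex; apply: ie; rewrite ex linear0.
by exists b, e; exists e' => [x|y]; rewrite ?e'E //; have [x <-] := se y; rewrite e'E.
Qed.

Lemma residue_field_cyclic : exists v : residue_field m, cyclic_module v (fun r => r \in m).
Proof.
have [g [sg gk]] := quot_ex (ideal_submod m).
have gE r : g (r : R^o) = (r : R) *: g 1 by rewrite -linearZ /= /GRing.scale /= mulr1.
exists (g 1); split=> [w|r]; first by have [r <-] := sg w; exists r; rewrite gE.
by rewrite -gE gk.
Qed.

End Freeness.

(** The Cohen-Macaulay and canonical conditions each supply their own value of the dimension; this
    identifies them. *)
Lemma krull_dim_unique (R : comNzRingType) d d' : krull_dim R d -> krull_dim R d' -> d = d'.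
Proof.
move=> [[c cc] cd] [[c' cc'] cd']; apply/eqP; rewrite eqn_leq.
by rewrite (cd' _ _ cc) (cd _ _ cc').
Qed.

Theorem corollary3p27 (R : comNzRingType) (m : idealr R) (d : nat)
    (omega M : lmodType R) (q p : nat)
    (phi : {linear 'rV[R]_q -> 'rV[R]_p}) (e : {linear 'rV[R]_p -> M}) :
  noetherian R -> local_ring m -> cohen_macaulay_ring m ->
  krull_dim R d -> (1 <= d)%N ->
  canonical_module m omega ->
  maximal_cohen_macaulay m M -> vector_bundle m M ->
  minimal_presentation m phi e ->
  ((forall i, (1 <= i <= d)%N -> is_zero (Ext i M M)) ->
   is_zero (Ext d.+1 (transpose phi) (Hom_mod M omega)) ->
   is_free M)
  /\ (finite_pd (dual_mod M) \/ finite_id (Hom_mod M omega) ->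
      is_zero (Ext d.+1 (transpose phi) (Hom_mod M omega))).
Proof.
move=> noeth loc [d1 [kd1 [[s [sd sm reg]] _]]] kd d0.
move=> [[fw nw [d2 [kd2 [[sw [swd swm wreg]] _]]]] idw [d3 [kd3 exk]]].
move=> [fM nM [d4 [kd4 [[sM [sMd sMm Mreg]] _]]]] vb mp.
move: sd swd sMd exk.
rewrite -(krull_dim_unique kd kd1) -(krull_dim_unique kd kd2).
rewrite -(krull_dim_unique kd kd3) -(krull_dim_unique kd kd4) => sd swd sMd exk.
have [se ee _ _] := mp.
have ew X j : finitely_generated X -> (d < j)%N -> ext_zero j X omega.
  exact: (ext_zero_above_dim noeth loc kd sd reg fw idw).
have fT := transpose_fg phi.
have fMw := fg_hom noeth fM fw.
have [v cv] := residue_field_cyclic m.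
split=> [_ /Ext_is_zero eT|[pd|id]]; last 2 first.
- apply/Ext_is_zero.
  apply: (ext_zero_coef_above_dim (d := d) noeth loc fT _ fw nw) => // [|j]; last exact: ew.
  have [n nE] := finite_pd_ext_zero pd.
  (* The shift by two is that of M^* as a second syzygy of the transpose. *)
  exists n.+2 => N [|[|[|j]]] // nj; apply: (transpose_ext_zero se ee).
  exact: nE.
- apply/Ext_is_zero.
  exact: (ext_zero_above_dim noeth loc kd sd reg fMw id fT).
have eM j : ext_zero j.+1 M omega.
  apply: (ext_zero_depth noeth loc sMm Mreg fM fw ew) => //.
  by rewrite sMd addSn ltnS leq_addl.
have sf x : x \in sw -> exists l, free_factor M (x ^+ l).
  by move=> /swm; apply: vector_bundle_free_factor se ee vb x.
have [g [sg eg]] := transpose_presentation phi.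
have [c [C eC]] := mx_syzygy (lin1_mx phi)^T noeth.
have [H [Y [h [i [ii eh hi fH [H0 eH]]]]]] :=
  ext_zero_top_homology noeth eM swd wreg sf ew fM d0 sg eg eT eC.
(* A nonzero H would map onto the residue field k with kernel [K]. Since Ext^(d-1)(K, omega) and
   Ext^d(H, omega) vanish, so would Ext^d(k, omega), which is isomorphic to k. *)
have zH : is_zero H.
  apply: contrapT => nH; have [f fs] := surj_residue noeth loc fH nH cv.
  have [K [k sK]] := ker_ses fs; have [ik _ _] := sK.
  have {}eK : ext_zero d.-1 K omega.
    apply: (ext_zero_homology (d := d) swd wreg sf); last by rewrite prednK.
    by move=> a fa x; apply: ik; rewrite linearZ /= (H0 a fa) linear0.
  have ek : is_zero (Ext d (residue_field m) omega).
    rewrite -(prednK d0); apply/Ext_is_zero; apply: (ext_zero_sesr sK eK).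
    by rewrite prednK.
  have [t [t' tK t'K]] := exk.
  have [gv av] := cv; have : (1 : R) *: v = 0.
    by rewrite scale1r -[v]t'K (ek (t' v)) linear0.
  by move/av; rewrite idealr1.
(* [z] corresponds to the identity of M and is a cycle because [e] kills the relations. As H = 0 it
   is a boundary, the image of [w]. *)
pose z : pow p M := fun j => e (delta_mx 0 j).
have [x xz] : exists x, i x = h z.
  apply: hi; apply/funext => j; rewrite /mx_action /z.
  rewrite [RHS](_ : _ = e (phi (delta_mx 0 j))); last by rewrite (exact0 ee).
  rewrite [phi _]row_sum_delta linear_sum; apply: eq_bigr => k _.
  by rewrite linearZ /= !mxE.
have /eh[w wz] : h z = 0 by rewrite -xz (zH x) linear0.
apply: (free_of_free_factor noeth loc mp).
(* [C^T] kills the image of [phi], because C times the transposed matrix of [phi] is zero, so it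
   descends to M. Composed with the map [r] given by [w] it is the identity. *)
have [|f fE] := @surj_factor_ex _ _ _ _ e (mulmxr C^T) se.
  move=> _ /ee[y <-] /=; rewrite -[phi y]mul_rV_lin1 -mulmxA.
  by rewrite -[lin1_mx phi]trmxK -trmx_mul (mx_exact0 eC) trmx0 mulmx0.
have [r rE] : exists r : {linear 'rV[R]_c -> M}, forall y, r y = \sum_k y 0 k *: (w : 'I_c -> M) k.
  apply: linear_ex => a y y'; rewrite scaler_sumr -big_split /=.
  by apply: eq_bigr => k _; rewrite !mxE scalerDl scalerA.
exists c, f, r => y; have [t <-] := se y; rewrite scale1r fE rE.
rewrite [in LHS](row_sum_delta t) linear_sum /=.
under [RHS]eq_bigr do rewrite mxE scaler_suml.
rewrite exchange_big; apply: eq_bigr => j _; rewrite linearZ /=.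
have -> : e (delta_mx 0 j) = \sum_k C k j *: (w : 'I_c -> M) k.
  by rewrite -[LHS]/((z : 'I_p -> M) j) -wz.
by rewrite scaler_sumr; apply: eq_bigr => k _; rewrite mxE scalerA.
Qed.
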